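(* Graphs of diameter three satisfy the Chen--Chvátal conjecture: if $G=(V,E)$ is a finite simple graph of diameter $3$, then either $G$ has a universal line, i.e. there exist distinct $x,y\in V$ with $\overline{xy}=V$, or $G$ has at least $|V|$ distinct lines, i.e. $\ell(G)\ge |V|$.
   Context: Graphs are finite, simple and undirected. For a connected graph $G=(V,E)$, $d(x,y)$ is the minimum number of edges of a path joining $x$ and $y$, and the diameter is the maximum of $d(x,y)$ over $x,y\in V$ (in particular a graph of diameter $3$ is connected). For three distinct vertices, $[xzy]$ means $d(x,y)=d(x,z)+d(z,y)$. The line generated by distinct vertices $x,y$ is $$\overline{xy}=\{x,y\}\cup\{z\in V\setminus\{x,y\}: [zxy]\text{ or }[xzy]\text{ or }[xyz]\}.$$ $\mathcal{L}(G)=\{\overline{xy}: x,y\in V,\ x\neq y\}$ is the set of lines (as subsets of $V$) and $\ell(G)=|\mathcal{L}(G)|$. *)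

(* Defs.v *)
From mathcomp Require Import all_boot.

Set Implicit Arguments.
Unset Strict Implicit.
Unset Printing Implicit Defensive.

Section GraphMetric.

Variables (T : finType) (e : rel T).

Definition connected_graph : Prop := forall x y : T, connect e x y.

(* MathComp's [path] allows repeated vertices, hence the [uniq] conjunct. *)
Definition has_path_of_length (x y : T) (n : nat) : bool :=
  [exists p : n.-tuple T, [&& path e x p, last x p == y & uniq (x :: p)]].

(* Paths have fewer than #|T| edges, so the range of the minimum is exhaustive;
   the value is the dummy #|T| when no path joins x and y, so dist and diameter
   are only meaningful on connected graphs. *)
Definition dist (x y : T) : nat :=
  \big[minn/#|T|]_(n < #|T| | has_path_of_length x y n) n.

Definition diameter : nat := \max_(x : T) \max_(y : T) dist x y.

(* [between x z y] is [xzy]: z is the middle point. *)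
Definition between (x z y : T) : bool :=
  uniq [:: x; z; y] && (dist x y == dist x z + dist z y).

Definition line (x y : T) : {set T} :=
  [set x; y] :|:
  [set z in ~: [set x; y] | [|| between z x y, between x z y | between x y z]].

Definition lines : {set {set T}} :=
  [set line x y | x in T, y in T & x != y].

End GraphMetric.

(* Main.v *)
Require Import Defs.
From mathcomp Require Import all_boot zify.
Set Implicit Arguments. Unset Strict Implicit. Unset Printing Implicit Defensive.

(* Fix [x], [y] at distance 3 and sort the other vertices by their pair of distances
   [(d x z, d y z)].  A line through [x] and a point at distance at least 2 contains no other
   point at the same distance from [x]; so lines of this kind with the same pole coincide
   only in pairs, at distances 2 and 3.  Every vertex is at distance at least 2 from [x] or
   from [y], so the lines from [x] and from [y] to distant vertices already number almost
   [#|T|]: besides their few coincidences, only one line is missing.  The deficit is made up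
   by lines that contain neither [x] nor [y], or by lines of edges that contain both.

   If some [v] at distance 2 from [x] satisfies [line x v = line x y] (a special pair), then
   [v] is the only vertex of type [(2, 1)] and the whole graph near [x], [y] is rigid enough
   to exhibit the missing lines.  If there is no such triple anywhere in the graph, the lines
   from [x] to distinct distant vertices are all distinct, and coincidences occur only
   between some [line x v] and [line y u] with [u] of type [(1, 2)] and [v] of type
   [(2, 1)]; such a line is reduced to the path [x], [u], [v], [y]. *)

(** * Distances and lines *)

Record graph_metric3 (T : finType) (d : T -> T -> nat) : Prop := GraphMetric3 {
  gm_refl x : d x x = 0;
  gm_sep x y : d x y = 0 -> x = y;
  gm_sym x y : d x y = d y x;
  gm_tri z x y : d x y <= d x z + d z y;
  gm_le3 x y : d x y <= 3;
  gm_split x y k : d x y = k.+1 -> exists2 z, d x z = 1 & d z y = k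
}.

Definition collinear (T : finType) (d : T -> T -> nat) x y z :=
  [|| d x y == d x z + d y z, d x z == d x y + d y z | d y z == d x y + d x z].

(* No case distinction as in [line]; [mline d x x] is the full set. *)
Definition mline (T : finType) (d : T -> T -> nat) x y :=
  [set z | collinear d x y z].

Definition mlines (T : finType) (d : T -> T -> nat) : {set {set T}} :=
  [set mline d x y | x in T, y in T & x != y].

Lemma bigminn_le (I : eqType) (r : seq I) (P : pred I) (F : I -> nat) m i :
  i \in r -> P i -> \big[minn/m]_(j <- r | P j) F j <= F i.
Proof.
elim: r => // j r IHr; rewrite inE big_cons => /orP[/eqP <- -> | ir Pi].
  exact: geq_minl.
by case: ifP => _; [apply: leq_trans (geq_minr _ _) _|]; apply: IHr.
Qed.

Section Dist.
Variables (T : finType) (e : rel T).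
Hypotheses (e_sym : symmetric e) (e_conn : connected_graph e).

Lemma dist_le_path x p : path e x p -> dist e x (last x p) <= size p.
Proof.
move=> ep; case/shortenP: ep => p' ep' up' sub.
have lt : size p' < #|T|.
  by have := max_card (mem (x :: p')); rewrite (card_uniqP up').
have sz : size p' <= size p by apply: uniq_leq_size => //; case/andP: up'.
apply: leq_trans sz; apply: (@bigminn_le _ _ _ _ _ (Ordinal lt)).
  by rewrite mem_index_enum.
by apply/existsP; exists (in_tuple p'); apply/and3P.
Qed.

Lemma dist_path x y :
  exists p, [/\ path e x p, last x p = y & size p = dist e x y].
Proof.
have [p0 ep0 y_def] := connectP (e_conn x y).
have lt : dist e x y < #|T|.
  rewrite y_def; case/shortenP: ep0 => p ep up _.
  apply: leq_ltn_trans (dist_le_path ep) _.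
  by have := max_card (mem (x :: p)); rewrite (card_uniqP up).
(* A fold of [minn] returns one of its arguments or the default [#|T|]; the strict bound [lt]
   excludes the default. *)
have: dist e x y = #|T| \/ exists2 n, has_path_of_length e x y n & dist e x y = n.
  rewrite /dist; apply: (big_ind (fun m => m = #|T| \/
    exists2 n, has_path_of_length e x y n & m = n)); first by left.
    move=> m n Hm Hn; rewrite /minn; case: ifP => _ //.
  by move=> i Hi; right; exists (val i).
rewrite /has_path_of_length; case=> [eqT|[n /existsP[p /and3P[ep /eqP lp _]] ->]]; first by rewrite eqT ltnn in lt.
by exists p; rewrite size_tuple.
Qed.

Lemma dist_sym_le x y : dist e y x <= dist e x y.
Proof.
have [p [ep <- <-]] := dist_path x y.
have ep' : path e (last x p) (rev (belast x p)).
  by rewrite rev_path; under eq_path do rewrite e_sym.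
have := dist_le_path ep'; rewrite size_rev size_belast.
suff -> : last (last x p) (rev (belast x p)) = x by [].
by case: p {ep ep'} => //= a p; rewrite rev_cons last_rcons.
Qed.

Lemma dist_graph_metric : (forall x y, dist e x y <= 3) -> graph_metric3 (dist e).
Proof.
move=> le3; split=> //.
- by move=> x; apply/eqP; rewrite -leqn0; apply: (@dist_le_path x [::]).
- by move=> x y dxy; have [p [_ lp]] := dist_path x y; rewrite dxy => /size0nil p0; rewrite -lp p0.
- by move=> x y; apply/eqP; rewrite eqn_leq !dist_sym_le.
- move=> z x y; have [p [ep lp <-]] := dist_path x z.
  have [q [eq <- <-]] := dist_path z y; subst z.
  by rewrite -size_cat -last_cat; apply: dist_le_path; rewrite cat_path ep.
move=> x y k dxy; have [[|z p] [/= ep lp]] := dist_path x y; rewrite dxy // => -[sp].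
case/andP: ep => exz ep; exists z.
  apply/eqP; rewrite eqn_leq (@dist_le_path x [:: z]) /= ?exz //.
  rewrite lt0n; apply/eqP => dxz.
  have [q [_ + +]] := dist_path x z; rewrite dxz => + /size0nil q0; rewrite q0 /= => xz.
  by have := dist_le_path ep; rewrite lp sp -xz dxy ltnn.
apply/eqP; rewrite eqn_leq -{1}lp -sp dist_le_path //= -ltnS sp -dxy.
have [q [eq <- <-]] := dist_path z y.
by apply: (@dist_le_path x (z :: q)); rewrite /= exz.
Qed.

Lemma mline_dist x y :
  graph_metric3 (dist e) -> x != y -> mline (dist e) x y = line e x y.
Proof.
move=> M xy; apply/setP => z; rewrite !inE /collinear /between /= !inE.
have [->|zx] := eqVneq z x; first by rewrite (gm_refl M) (gm_sym M y x) eqxx.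
have [->|zy] := eqVneq z y; first by rewrite (gm_refl M) addn0 eqxx.
rewrite !orbF !andbT xy /= (gm_sym M z x) (gm_sym M z y).
by rewrite [dist e x z + dist e x y]addnC; do 3!case: (_ == _).
Qed.

End Dist.

(** * Deciding statements about finitely many distances *)

(* [brute] proves a statement about finitely many distances by enumerating the four possible
   values of each of them: instances of [boolGoal] and [boolHyp] translate the goal into a
   boolean formula, which is evaluated.  It uses the hypotheses [d p q = k] of the context;
   [tri p q r ..] supplies the triangle inequalities. *)
Class boolGoal (P : Prop) (b : bool) := boolGoalP : b -> P.
Class boolHyp (P : Prop) (b : bool) := boolHypP : P -> b.

#[export] Instance goal_true b : boolGoal (is_true b) b := id.
#[export] Instance goal_false : boolGoal False false.
Proof. by []. Qed.
#[export] Instance goal_eqn (m n : nat) : boolGoal (m = n) (m == n).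
Proof. by move=> /eqP. Qed.
#[export] Instance goal_eqb (m n : bool) : boolGoal (m = n) (m == n).
Proof. by move=> /eqP. Qed.
#[export] Instance goal_and P Q p q :
  boolGoal P p -> boolGoal Q q -> boolGoal (P /\ Q) (p && q).
Proof. by move=> HP HQ /andP[/HP ? /HQ]. Qed.
#[export] Instance goal_or P Q p q :
  boolGoal P p -> boolGoal Q q -> boolGoal (P \/ Q) (p || q).
Proof. by move=> HP HQ /orP[/HP|/HQ]; [left|right]. Qed.
(** The boolean is an [if] rather than [==>]: under the call-by-value [vm_compute] the conclusion is
    then evaluated only where the hypothesis holds, which prunes the enumeration. *)
#[export] Instance goal_imp P Q p q :
  boolHyp P p -> boolGoal Q q -> boolGoal (P -> Q) (if p then q else true).
Proof. by move=> HP HQ + /HP h; rewrite h => /HQ. Qed.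
#[export] Instance goal_not P p : boolHyp P p -> boolGoal (~ P) (~~ p).
Proof. by move=> HP /negP np /HP. Qed.
#[export] Instance goal_all3 (P : nat -> Prop) (b : nat -> bool) :
  (forall n, boolGoal (P n) (b n)) ->
  boolGoal (forall n, n <= 3 -> P n)
    (if b 0 then if b 1 then if b 2 then b 3 else false else false else false).
Proof.
move=> H; case: ifP => // b0; case: ifP => // b1; case: ifP => // b2 b3.
by case=> [|[|[|[|n]]]] // _; apply: H.
Qed.
#[export] Instance hyp_true b : boolHyp (is_true b) b := id.
#[export] Instance hyp_eqn (m n : nat) : boolHyp (m = n) (m == n).
Proof. by move=> /eqP. Qed.
#[export] Instance hyp_eqb (m n : bool) : boolHyp (m = n) (m == n).
Proof. by move=> /eqP. Qed.
#[export] Instance hyp_not P p : boolGoal P p -> boolHyp (~ P) (~~ p).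
Proof. by move=> HP nP; apply/negP => /HP. Qed.
#[export] Instance hyp_or P Q p q :
  boolHyp P p -> boolHyp Q q -> boolHyp (P \/ Q) (p || q).
Proof. by move=> HP HQ [/HP ->|/HQ ->]; rewrite ?orbT. Qed.
#[export] Instance hyp_imp P Q p q :
  boolGoal P p -> boolHyp Q q -> boolHyp (P -> Q) (p ==> q).
Proof. by move=> HP HQ H; apply/implyP => /HP /H /HQ. Qed.

Lemma mem_mline (T : finType) (d : T -> T -> nat) x y z :
  (z \in mline d x y) = [|| d x y == d x z + d y z, d x z == d x y + d y z | d y z == d x y + d x z].
Proof. by rewrite inE. Qed.

Lemma gm_triangles (T : finType) (d : T -> T -> nat) (M : graph_metric3 d) x y z :
  (d x y <= d x z + d y z) && (d x z <= d x y + d y z) && (d y z <= d x y + d x z).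
Proof.
rewrite -andbA; apply/and3P; split.
- by rewrite (gm_sym M y z) gm_tri.
- exact: gm_tri.
- by rewrite (gm_sym M x y) gm_tri.
Qed.

Ltac pose_metric p q r :=
  match goal with M : graph_metric3 _ |- _ => generalize (gm_triangles M p q r) end.

Tactic Notation "tri" constr(p) constr(q) constr(r) := pose_metric p q r.
Tactic Notation "tri" constr(p) constr(q) constr(r) constr(s) :=
  pose_metric p q r; pose_metric p q s; pose_metric p r s; pose_metric q r s.
Tactic Notation "tri" constr(p) constr(q) constr(r) constr(s) constr(t) :=
  tri p q r s; pose_metric p q t; pose_metric p r t; pose_metric p s t;
  pose_metric q r t; pose_metric q s t; pose_metric r s t.

Ltac brute :=
  lazymatch goal with M : graph_metric3 ?d |- _ =>
    rewrite ?mem_mline; unfold collinear; rewrite ?(gm_refl M);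
    repeat match goal with
    | H : d ?p ?q = ?k |- context[d ?p ?q] => rewrite H
    | H : d ?p ?q = ?k |- context[d ?q ?p] => rewrite (gm_sym M q p) H
    end;
    repeat match goal with |- context[d ?p ?q] =>
      match goal with |- context[d q p] =>
        tryif constr_eq p q then fail else rewrite (gm_sym M q p) end end;
    repeat match goal with |- context[d ?p ?q] =>
       generalize (gm_le3 M p q); generalize (d p q) end;
    apply: (@boolGoalP _ _ _); first [vm_compute; reflexivity | fail 1]
  end.

(** * Lines through two vertices at distance three *)

Section MetricLemmas.
Variables (T : finType) (d : T -> T -> nat).
Hypothesis M : graph_metric3 d.
Local Notation L := (mline d).

(** A point at distance 2 from [x] adjacent to [z'] lies on the common line, where [z] is the only
    point at that distance; likewise for [z']. A neighbour of [x] at distance 3 from [z] would be on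
    the line, hence at distance 2 from [z'], and the middle vertex of that path would have to be
    [z]. *)
Lemma eq_lines_2_3 x z z' : d x z = 2 -> d x z' = 3 -> L x z = L x z' ->
  [/\ d z z' = 1, forall w, d x w = 2 -> d z' w = 1 -> w = z,
   forall w, d x w = 3 -> d z w = 1 -> w = z' & forall w, d x w = 1 -> d z w <> 3].
Proof.
move=> xz xz' E; have Ew w : (w \in L x z) = (w \in L x z') by rewrite E.
have zz' : d z z' = 1 by tri x z z'; move: (Ew z'); brute.
have uz w : d x w = 2 -> d z' w = 1 -> w = z.
  by move=> xw zw; apply: (gm_sep M); move: (Ew w); tri x z z' w; brute.
split=> // w xw.
  by move=> zw; apply: (gm_sep M); move: (Ew w); tri x z z' w; brute.
move=> zw; have wz' : d w z' = 2 by move: (Ew w); tri x z z' w; brute.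
have [p wp pz'] := gm_split M wz'.
have pz: p = z by apply: uz; [tri x w p z' | ]; brute.
by move: zw wp; rewrite pz; brute.
Qed.
End MetricLemmas.

(** * Counting lines by which of the two poles they contain *)

Section Counting.
Variables (T : finType) (d : T -> T -> nat).
Hypothesis M : graph_metric3 d.
Local Notation L := (mline d).

Lemma mlineC x y : L x y = L y x.
Proof. by apply/setP => z; brute. Qed.

Lemma card_sum_mem (I : finType) (P : {set I}) : #|P| = \sum_i (i \in P).
Proof. by rewrite -sum1_card big_mkcond; apply: eq_bigr => i _; case: (i \in P). Qed.

Lemma gm_eq0 x y : (x == y) = (d x y == 0).
Proof.
by apply/eqP/eqP => [->|/(gm_sep M)//]; rewrite (gm_refl M).
Qed.

Lemma mem_mlines x y : 0 < d x y -> L x y \in mlines d.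
Proof.
move=> xy; apply/imset2P; exists x y => //; rewrite !inE /=.
by apply/eqP => xy0; rewrite xy0 (gm_refl M) in xy.
Qed.

(** Two distinct points at equal distance from [x] on a line through [x] are twice that distance
    apart, here at least 4. *)
Lemma mline_inj x p q : 2 <= d x p -> d x p = d x q -> L x p = L x q -> p = q.
Proof.
move=> xp xpq E; apply: (gm_sep M).
have: (q \in L x p) = (q \in L x q) by rewrite E.
by move: xp xpq; tri x p q; brute.
Qed.

Definition offside x y := [set z | (2 <= d x z) && (y \notin L x z)].
Definition blocked x := [set z | [exists z', [&& d x z == 2, d x z' == 3 & L x z == L x z']]].
Definition sphere2 x y i j := [set z | (d x z == i) && (d y z == j)].
(* The lines counted through [offside x y] and [offside y x] contain exactly one of [x] and
   [y]; [S] stands for some lines that contain both. *)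
Definition fresh x y (S : {set {set T}}) :=
  [set l in mlines d | ((x \in l) == (y \in l)) && (l \notin S)].

Lemma blockedP x z : z \in blocked x ->
  exists z', [/\ d x z = 2, d x z' = 3 & L x z = L x z'].
Proof.
by rewrite inE => /existsP[z' /and3P[/eqP ? /eqP ? /eqP ?]]; exists z'.
Qed.

Lemma blockedI x z z' : d x z = 2 -> d x z' = 3 -> L x z = L x z' -> z \in blocked x.
Proof. by move=> xz xz' E; rewrite inE; apply/existsP; exists z'; rewrite xz xz' E !eqxx. Qed.

Lemma in_sphere2 x y i j z : (z \in sphere2 x y i j) = (d x z == i) && (d y z == j).
Proof. by rewrite inE. Qed.

(** By [mline_inj], a coincidence pairs a point at distance 2 with one at distance 3, and the former
    is in [blocked x]. *)
Lemma card_offside_lines x y :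
  #|offside x y :\: blocked x| <= #|[set l in mlines d | (x \in l) && (y \notin l)]|.
Proof.
rewrite -(card_in_imset (f := L x)).
  apply/subset_leq_card/subsetP => l /imsetP[z + ->].
  rewrite 3!inE => /and3P[_ xz yz]; rewrite inE mem_mlines ?yz ?(ltnW xz) //=.
  by rewrite andbT; brute.
move=> p q; rewrite 2!in_setD !(in_set (fun z => (2 <= _) && _)).
move=> /andP[bp /andP[xp _]] /andP[bq /andP[xq _]] E.
have [xpq|xpq] := eqVneq (d x p) (d x q); first exact: mline_inj xp xpq E.
have {}xpq : d x p = 2 /\ d x q = 3 \/ d x p = 3 /\ d x q = 2.
  by move: xp xq xpq; brute.
case: xpq => [] [xp' xq'].
  by rewrite (blockedI xp' xq' E) in bp.
by rewrite (blockedI xq' xp' (esym E)) in bq.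
Qed.

Variables (x y : T).
Hypothesis xy : d x y = 3.

(** The vertices on [L x y] are those whose distances to [x] and [y] add up to 3: the poles and the
    types (1, 2) and (2, 1). Any other vertex is offside for some pole, and for both exactly when
    both distances are at least 2. *)
Lemma card_offside :
  #|T| + #|offside x y :&: offside y x| =
  2 + #|sphere2 x y 1 2| + #|sphere2 x y 2 1| + #|offside x y| + #|offside y x|.
Proof.
have n2 : #|[set x; y]| = 2 by rewrite cards2 gm_eq0 xy.
rewrite -{1}n2 -cardsT !card_sum_mem -!big_split /=; apply: eq_bigr => z _.
by rewrite !inE !(eq_sym z) !gm_eq0; tri x y z; brute.
Qed.

(** Four disjoint classes of lines are added up: those containing only [x], those containing only
    [y], [S], and the fresh ones. *)
Lemma card_lines_ge (S : {set {set T}}) :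
  S \subset mlines d -> (forall l, l \in S -> (x \in l) && (y \in l)) ->
  #|T| + #|offside x y :&: offside y x| + #|S| + #|fresh x y S| <=
  #|mlines d| + 2 + #|sphere2 x y 1 2| + #|sphere2 x y 2 1| +
  #|offside x y :&: blocked x| + #|offside y x :&: blocked y|.
Proof.
move=> Ssub Sxy; rewrite card_offside.
have := card_offside_lines x y; have := card_offside_lines y x.
have := cardsID (blocked x) (offside x y); have := cardsID (blocked y) (offside y x).
set X := [set l in _ | _ && _]; set Y := [set l in _ | _ && _].
suff: #|X| + #|Y| + #|S| + #|fresh x y S| <= #|mlines d| by lia.
rewrite !card_sum_mem -!big_split /=; apply: leq_sum => l _.
have := Sxy l; have := subsetP Ssub l; rewrite !inE.
case: (l \in S) => [/(_ isT)-> /(_ isT)/andP[-> ->]|_ _] //=.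
by case: (l \in mlines d); case: (x \in l); case: (y \in l).
Qed.
End Counting.

(** * Balancing lost lines against vertices far from both poles *)

Section Blocked.
Variables (T : finType) (d : T -> T -> nat).
Hypothesis M : graph_metric3 d.
Local Notation L := (mline d).
Local Notation blocked := (blocked d).
Local Notation offside := (offside d).
Local Notation sphere2 := (sphere2 d).
Variables (x y : T).
Hypothesis xy : d x y = 3.

(* The line from [c] to [x] and the line from [c] to [y] are both lost for the count.  Only the
   case in which the second one is [mline y a] with [a] adjacent to [x] costs a line; the
   other cases are compensated, see [card_blocked]. *)
Definition doubly_blocked x y :=
  [set c in sphere2 x y 2 2 | (c \in blocked x) &&
    [exists a, [&& d x a == 1, d y a == 3 & L y c == L y a]]].
(** Vertices far from both poles that lose neither of their two lines. Those at distance 3 from [y]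
    are left out, being reserved to pay for vertices blocked twice. *)
Definition unblocked x y :=
  (sphere2 x y 2 2 :\: (blocked x :|: blocked y)) :|: (sphere2 x y 3 2 :\: blocked y).

Lemma blocked_d z w : w \in blocked z -> d z w = 2.
Proof. by case/blockedP => w' []. Qed.

(* A vertex [c] that is blocked for [x] and for [y] is charged to the point [w] with
   [L y c = L y w], or, if the line from [x] to that point [t] is lost too, to the point [w]
   with [L x t = L x w]. *)
Let relieves c w :=
  [&& d y w == 3, 2 <= d x w, L y c == L y w & (d x w == 3) || (w \notin blocked x)] ||
  [exists t, [&& d x t == 2, d y t == 3, L y c == L y t, L x t == L x w, d x w == 3 & d y w == 3]].

(** Within one clause of [relieves], [w] determines [c] by [mline_inj]. The clauses cannot mix: [c]
    from the first and [t] from the second would both be the unique neighbour of [w] at distance 2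
    from [x], but their distances from [y] differ. *)
Lemma relieves_inj c c' w : d x c = 2 -> d y c = 2 -> d x c' = 2 -> d y c' = 2 ->
  relieves c w -> relieves c' w -> c = c'.
Proof.
have cross a a' : d x a = 2 -> d y a = 2 -> d y w = 3 -> L y a = L y w ->
    [exists t, [&& d x t == 2, d y t == 3, L y a' == L y t, L x t == L x w, d x w == 3 & d y w == 3]] -> False.
  move=> xa ya yw Ea /existsP[t /and5P[/eqP xt /eqP yt _ /eqP Et /andP[/eqP xw _]]].
  have [aw _ _ _] := eq_lines_2_3 M ya yw Ea; have [_ ut _ _] := eq_lines_2_3 M xt xw Et.
  have eat : a = t by apply: ut => //; rewrite (gm_sym M).
  by move: ya; rewrite eat yt.
move=> xc yc xc' yc' /orP[/and4P[/eqP yw _ /eqP Ec _]|Hc] /orP[/and4P[/eqP yw' _ /eqP Ec' _]|Hc'].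
- by apply: (mline_inj M (x := y)); rewrite ?yc ?yc' // Ec Ec'.
- by case: (cross c c' xc yc yw Ec Hc').
- by case: (cross c' c xc' yc' yw' Ec' Hc).
case/existsP: Hc => [t /and5P[/eqP xt /eqP yt /eqP Et /eqP Ew _]].
case/existsP: Hc' => [t' /and5P[/eqP xt' /eqP yt' /eqP Et' /eqP Ew' _]].
have tt' : t = t' by apply: (mline_inj M (x := x)); rewrite ?xt ?xt' // Ew Ew'.
by apply: (mline_inj M (x := y)); rewrite ?yc ?yc' // Et Et' tt'.
Qed.

Let Q := sphere2 x y 2 2 :&: blocked x :&: blocked y :\: doubly_blocked x y.
(** These vertices lie in both offside sets and lose no line, so each can pay for one member of
    [Q]. *)
Let K := (sphere2 x y 2 3 :\: blocked x) :|: sphere2 x y 3 3.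

Lemma relieves_ex c : c \in Q -> exists2 w, w \in K & relieves c w.
Proof.
rewrite !in_setD !in_setI => /andP[nq /andP[/andP[c2 bx] /blockedP[a [yc ya Ea]]]].
have xc : d x c = 2 by move: c2; rewrite inE => /andP[/eqP].
have [ca uc ua nc] := eq_lines_2_3 M yc ya Ea.
have xa : 2 <= d x a.
  rewrite ltn_neqAle; apply/andP; split; last by tri x c a; brute.
  apply: contra nq => xa1; rewrite inE c2 bx; apply/existsP; exists a.
  by rewrite eq_sym xa1 ya Ea !eqxx.
have [h|] := boolP ((d x a == 3) || (a \notin blocked x)).
  exists a; last by rewrite /relieves ya xa Ea h !eqxx.
  rewrite in_setU in_setD; move: xa h; case: (a \in blocked x); rewrite !inE; brute.
rewrite negb_or negbK => /andP[xa3 /blockedP[w [xa2 xw Ew]]].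
have [aw uaw _ _] := eq_lines_2_3 M xa2 xw Ew.
(* Being adjacent to [a], [w] could otherwise only be at distance 2 from [y]; it would then be [c],
   which is too close to [x]. *)
have yw : d y w = 3.
  apply/eqP; apply: contraT => yw; have wc : w = c.
    by apply: uc; rewrite ?aw //; move: yw; tri y w a x; brute.
  by move: xw; rewrite wc xc.
exists w; first by rewrite !inE xw yw !eqxx !orbT.
apply/orP; right; apply/existsP; exists a.
by rewrite xa2 ya Ea Ew xw yw !eqxx.
Qed.

Lemma card_blocked :
  #|offside x y :&: blocked x| + #|offside y x :&: blocked y| + #|unblocked x y| <=
  #|offside x y :&: offside y x| + #|doubly_blocked x y|.
Proof.
have leQ : #|Q| <= #|K|.
  pose f c := odflt c [pick w in K | relieves c w].
  have fP c : c \in Q -> f c \in K /\ relieves c (f c).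
    move=> cQ; rewrite /f; case: pickP => [w /andP[]//|no].
    by have [w wK cw] := relieves_ex cQ; have := no w; rewrite /= wK cw.
  rewrite -(card_in_imset (f := f)).
    by apply/subset_leq_card/subsetP => w /imsetP[c /fP[+ _] ->].
  move=> c c' cQ c'Q E; have [_ cc] := fP _ cQ; have [_ cc'] := fP _ c'Q.
  move: cQ c'Q; rewrite !in_setD !in_setI => /andP[_ /andP[/andP[+ _] _]].
  rewrite inE => /andP[/eqP ? /eqP ?] /andP[_ /andP[/andP[+ _] _]].
  rewrite inE => /andP[/eqP ? /eqP ?].
  by apply: (@relieves_inj c c' (f c)); rewrite // E.
(* Once [K] and [Q] are added, the inequality holds vertex by vertex. *)
suff: #|offside x y :&: blocked x| + #|offside y x :&: blocked y| + #|unblocked x y| + #|K|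
   <= #|offside x y :&: offside y x| + #|doubly_blocked x y| + #|Q| by lia.
rewrite !card_sum_mem -!big_split /=; apply: leq_sum => z _.
have := @blocked_d x z; have := @blocked_d y z.
rewrite /Q /K /unblocked in_setU !in_setD !in_setU !in_setD !in_setI.
have: (z \in doubly_blocked x y) ==> (z \in blocked y) && (z \in blocked x) && (z \in sphere2 x y 2 2).
  rewrite inE; apply/implyP => /and3P[zC -> /existsP[a /and3P[_ /eqP ya /eqP Ea]]].
  rewrite zC (blockedI _ ya Ea) //.
  by move: zC; rewrite inE => /andP[_ /eqP].
case: (z \in doubly_blocked x y); case: (z \in blocked x); case: (z \in blocked y); rewrite !inE; tri x y z; brute.
Qed.
End Blocked.

(** * Special pairs *)

Lemma card_ge_uniq (I : finType) (S : {set I}) (s : seq I) :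
  uniq s -> {subset s <= S} -> size s <= #|S|.
Proof.
by move=> /card_uniqP <- sub; apply/subset_leq_card/subsetP.
Qed.

Lemma neq_set_witness (I : finType) (z : I) (A B : {set I}) :
  (z \in A) != (z \in B) -> A != B.
Proof. by apply: contra_neq => ->. Qed.

Lemma uniq3 (I : eqType) (a b c : I) : a != b -> a != c -> b != c -> uniq [:: a; b; c].
Proof. by move=> ab ac bc; rewrite /= !inE negb_or ab ac bc. Qed.

Lemma uniq4 (I : eqType) (a b c e : I) : a != b -> a != c -> a != e ->
  b != c -> b != e -> c != e -> uniq [:: a; b; c; e].
Proof. by move=> ab ac ae bc be ce; rewrite /= !inE !negb_or ab ac ae bc be ce. Qed.

Ltac differ_at z0 := by apply: (neq_set_witness (z := z0)); brute.

Section SpecialPair.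
Variables (T : finType) (d : T -> T -> nat).
Hypothesis M : graph_metric3 d.
Local Notation L := (mline d).
Local Notation blocked := (blocked d).
Local Notation sphere2 := (sphere2 d).
Hypothesis nouniv : forall p q, 0 < d p q -> exists w, w \notin L p q.

Lemma gm_prev x w k : d x w = k.+1 -> exists2 z, d w z = 1 & d x z = k.
Proof.
rewrite (gm_sym M) => /(gm_split M)[z wz zx]; exists z => //.
by rewrite (gm_sym M).
Qed.

(* Equal lines through [w] force distances 2 and 3 from [w], and then [eq_lines_2_3] forbids the
   common neighbour to be at distance 2 or 3 from [w]. *)
Lemma pencil_neq w v p q : 2 <= d w p -> 2 <= d w q -> p <> q ->
  d v p = 1 -> d v q = 1 -> L w p != L w q.
Proof.
move=> wp wq pq vp vq; apply/eqP => E.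
have [Ed|Ed] := eqVneq (d w p) (d w q); first exact: pq (mline_inj M wp Ed E).
wlog [p2 q3] : p q wp wq pq vp vq E {Ed} / d w p = 2 /\ d w q = 3.
  move=> H; have: d w p = 2 /\ d w q = 3 \/ d w q = 2 /\ d w p = 3.
    by move: wp wq Ed; brute.
  by case=> h; [apply: (H p q)|apply: (H q p) => //; apply: nesym].
have [_ up uq _] := eq_lines_2_3 M p2 q3 E.
have v23 : d w v = 2 \/ d w v = 3 by tri w v p q; brute.
case: v23 => wv.
  by have vp' := up v wv; move: vp; rewrite -vp' ?(gm_refl M) // (gm_sym M).
by have vq' := uq v wv; move: vq; rewrite -vq' ?(gm_refl M) // (gm_sym M).
Qed.

(** Lines from [c] to points at distance 2 are pairwise distinct by [mline_inj]; [t] lists further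
    lines of [F] outside this pencil. *)
Lemma card_pencil (F : {set {set T}}) (S : {set T}) c (t : seq {set T}) :
  (forall p, p \in S -> d c p = 2 /\ L c p \in F) -> uniq t -> {subset t <= F} ->
  (forall p, p \in S -> all (fun l => L c p != l) t) -> #|S| + size t <= #|F|.
Proof.
move=> SF ut tF tS; pose s := [seq L c p | p in S].
have us : uniq s.
  rewrite map_inj_in_uniq ?enum_uniq // => p q; rewrite !mem_enum.
  by move=> /SF[cp _] /SF[cq _]; apply: (mline_inj M); rewrite cp // cq.
have := @card_ge_uniq _ F (s ++ t); rewrite size_cat size_map -cardE; apply.
  rewrite cat_uniq us ut andbT /=; apply/hasPn => l lt; apply/negP => /mapP[p].
  by rewrite mem_enum => pS El; have := allP (tS p pS) l lt; rewrite El eqxx.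
by move=> l; rewrite mem_cat => /orP[/mapP[p + ->]|/tF//]; rewrite mem_enum => /SF[].
Qed.

Lemma fresh_avoiding (S : {set {set T}}) x y p q :
  (forall l, l \in S -> x \in l) -> 0 < d p q -> x \notin L p q -> y \notin L p q ->
  L p q \in fresh d x y S.
Proof.
move=> Sx pq xl yl; rewrite inE (mem_mlines M pq) (negPf xl) (negPf yl) eqxx /=.
exact: contra (Sx _) xl.
Qed.

Section Special.
Variables (x y v : T).
Hypotheses (xy : d x y = 3) (xv : d x v = 2) (Ev : L x v = L x y).

Lemma special_facts :
  [/\ d v y = 1, forall w, d x w = 2 -> d y w = 1 -> w = v,
   forall w, d x w = 3 -> d v w = 1 -> w = y, forall w, d x w = 1 -> d v w <> 3 &
   forall a, d x a = 1 -> d y a = 2 -> d v a = 1].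
Proof.
have [vy uB uN n3] := eq_lines_2_3 M xv xy Ev; split=> // a xa ya.
(* A neighbour of [a] towards [y] has type (2, 1), and [v] is the only such vertex. *)
have [b ab yb] := gm_prev ya.
suff <- : b = v by rewrite (gm_sym M).
by apply: uB => //; tri x y a b; brute.
Qed.

(** Vertices of type (2, 1) contribute nothing here: the only one is [v], and its line from [x] is
    [L x y]. *)
Definition special_base := L x y |: [set L y u | u in sphere2 x y 1 2].
Local Notation fresh := (fresh d x y special_base).

Lemma special_inner : exists u, [/\ d x u = 1, d y u = 2 & d v u = 1].
Proof.
have [vy _ _ _ _] := special_facts; have [u vu xu] := gm_prev xv.
by exists u; split=> //; tri x y v u; brute.
Qed.

Lemma special_base_mem l : l \in special_base -> (x \in l) && (y \in l).
Proof.
rewrite in_setU1 => /orP[/eqP ->|/imsetP[u + ->]]; first by brute.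
by rewrite in_sphere2 => /andP[/eqP xu /eqP yu]; brute.
Qed.

Lemma special_fresh_avoiding p q :
  0 < d p q -> x \notin L p q -> y \notin L p q -> L p q \in fresh.
Proof. by apply: fresh_avoiding => l /special_base_mem/andP[]. Qed.

(** No line of [special_base] passes through a vertex at distance 2 from both poles. *)
Lemma special_fresh_through c p q : d x c = 2 -> d y c = 2 ->
  0 < d p q -> x \in L p q -> y \in L p q -> c \in L p q -> L p q \in fresh.
Proof.
move=> xc yc pq xl yl cl; rewrite inE (mem_mlines M pq) xl yl eqxx /=.
apply: contraL cl; rewrite /special_base in_setU1 => /orP[/eqP ->|/imsetP[u + ->]]; first by brute.
by rewrite inE => /andP[/eqP xu /eqP yu]; tri x y u c; brute.
Qed.

Lemma doubly_blockedP c : c \in doubly_blocked d x y ->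
  exists a b, [/\ [/\ d x c = 2, d y c = 2, d x a = 1, d y a = 3 & L y c = L y a],
    d x b = 3 & L x c = L x b].
Proof.
rewrite inE => /and3P[+ /blockedP[b [xc xb Eb]] /existsP[a /and3P[/eqP xa /eqP ya /eqP Ea]]].
by rewrite inE => /andP[_ /eqP yc]; exists a, b.
Qed.

(** A point off the line of the edge [v y] is equidistant from its ends; the clauses of
    [special_facts] then rule out neighbours of [x] and of [y]. *)
Lemma special_missed w : w \notin L v y ->
  [/\ d v w = d y w, 2 <= d x w & 2 <= d y w].
Proof.
have [vy uB uN n3 Av] := special_facts => wL.
have vwy : d v w = d y w by move: wL; tri v y w; brute.
have xw1 : d x w <> 1.
  move=> xw; have := n3 w xw.
  have yw2 : d y w <> 2 by move=> yw; move: vwy (Av w xw yw); brute.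
  by move: vwy yw2; tri x y w; tri x v w; brute.
have yw1 : d y w <> 1.
  move=> yw; have xw2' : d x w <> 2.
    by move=> xw; move: vwy; rewrite (uB w xw yw) (gm_refl M) -(uB w xw yw) yw.
  have xw : d x w = 3 by move: xw2'; tri x y w; brute.
  have vw : d v w = 1 by rewrite vwy.
  by move: yw; rewrite (uN w xw vw) (gm_refl M).
by split=> //; move: xw1 yw1 vwy; tri x v y w; brute.
Qed.

(* The lines from [a] to the doubly blocked vertices other than [c] are fresh. *)
Lemma anchor_lines c a (t : seq {set T}) :
  c \in doubly_blocked d x y -> d x a = 1 -> d y a = 3 -> L y c = L y a ->
  uniq t -> {subset t <= fresh} ->
  (forall c', d x c' = 2 -> d y c' = 2 -> d a c' = 2 -> all (fun l => L a c' != l) t) ->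
  #|doubly_blocked d x y| + size t <= #|fresh|.+1.
Proof.
move=> cQ xa ya Ea ut tf tneq; rewrite (cardsD1 c) cQ.
set Q' := _ :\ c.
(* Distance 1 from [a] would force [c' = c]; distance 3 is impossible because [c'] is blocked for
   [x] and [a] is adjacent to [x]. *)
have Q'P c' : c' \in Q' -> [/\ d x c' = 2, d y c' = 2 & d a c' = 2].
  rewrite in_setD1 => /andP[c'c /doubly_blockedP[a' [b' [[xc' yc' _ _ _] xb' Eb']]]].
  split=> //; have xc : d x c = 2 by have [? [? [[]]]] := doubly_blockedP cQ.
  have yc : d y c = 2 by have [? [? [[]]]] := doubly_blockedP cQ.
  have [_ uc _ _] := eq_lines_2_3 M yc ya Ea; have [_ _ _ nc'] := eq_lines_2_3 M xc' xb' Eb'.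
  have := nc' a xa; have ac' : d a c' <> 1 by move=> h; case/eqP: c'c; apply: uc.
  by move: ac'; tri x a c'; brute.
rewrite add1n addSn ltnS; apply: (card_pencil (c := a)) => // c' /Q'P[xc' yc' ac'].
  by split=> //; apply: special_fresh_avoiding; brute.
exact: tneq.
Qed.

(** A point [w] off the line of the edge [c a] is equidistant from both ends. It is not a common
    neighbour: at distance 2 from [y] it would be [c], at distance 3 it would be [a]. *)
Lemma anchor_missed c a :
  c \in doubly_blocked d x y -> d x a = 1 -> d y a = 3 -> L y c = L y a ->
  exists w, [/\ w \notin L c a, d c w = d a w, d c w = 2 \/ d c w = 3 & L c w \in fresh].
Proof.
move=> cQ xa ya Ea; have [_ [z [[xc yc _ _ _] xz Ez]]] := doubly_blockedP cQ.
have [ca ua ua' ny] := eq_lines_2_3 M yc ya Ea; have [_ _ _ nx] := eq_lines_2_3 M xc xz Ez.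
have [w wL] : exists w, w \notin L c a by apply: nouniv; brute.
have caw : d c w = d a w by move: wL; tri c a w; brute.
have cw2 : d c w = 2 \/ d c w = 3.
  have : d c w <> 1.
    move=> cw1; have aw1 : d a w = 1 by rewrite -caw.
    have yw : d y w = 2 \/ d y w = 3 by tri y c a w; brute.
    case: yw => yw.
      by move: cw1; rewrite (ua w yw aw1) (gm_refl M).
    by move: aw1; rewrite (ua' w yw cw1) (gm_refl M).
  by move: wL; tri c a w; brute.
exists w; split=> //.
case: cw2 => cw; have aw := cw; rewrite caw in aw;
  apply: special_fresh_avoiding; try by tri x a w; tri y a w; brute.
have yw : d y w <> 1 by move=> /(ny w).
by move: yw; tri y c w; brute.
Qed.

Lemma special_doubly_blocked c :
  c \in doubly_blocked d x y -> #|doubly_blocked d x y| + 2 <= #|fresh|.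
Proof.
move=> cQ; have [a [z [[xc yc xa ya Ea] xz Ez]]] := doubly_blockedP cQ.
(* [anchor_lines] already yields one line for each doubly blocked vertex except [c], so three more
   are enough. *)
suff [t [ut tf tneq st]]: exists t : seq {set T}, [/\ uniq t, {subset t <= fresh},
    forall c', d x c' = 2 -> d y c' = 2 -> d a c' = 2 -> all (fun l => L a c' != l) t
    & size t = 3].
  by have := anchor_lines cQ xa ya Ea ut tf tneq; rewrite st; lia.
have [ca ua ua' ny] := eq_lines_2_3 M yc ya Ea; have [cz uz uz' nx] := eq_lines_2_3 M xc xz Ez.
have [vy uB uN n3 Av] := special_facts.
have [u [xu yu vu]] := special_inner.
have va : d v a = 2 by move: (n3 a xa); tri v y a; brute.
have au : d a u = 2.
  have au1 : d a u <> 1 by move=> /(ua u yu) uc; move: xu; rewrite uc xc.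
  by move: au1; tri a u x y; brute.
have fca : L c a \in fresh by apply: (special_fresh_through xc yc); brute.
have [cv|cv] := eqVneq (d c v) 2.
  have fcv : L c v \in fresh by apply: special_fresh_avoiding; brute.
  have [cu|cu] := eqVneq (d c u) 2.
    have [b cb yb] := gm_prev yc.
    have xb : d x b = 3.
      have bv : d x b <> 2 by move=> h; move: cv; rewrite -(uB b h yb) cb.
      by move: bv; tri x y b; brute.
    have bz := uz' b xb cb; rewrite -bz in uz.
    have ub : d u b = 3.
      have ub2 : d u b <> 2.
        move=> /(gm_split M)[p up pb]; have xp : d x p = 2 by tri x u p b; brute.
        have pc : p = c by apply: uz => //; brute.
        by move: up; rewrite pc; brute.
      by move: ub2; tri x u b; brute.
    exists [:: L c v; L c a; L c b]; split=> //.
    - apply: uniq3.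
      + differ_at a.
      + differ_at y.
      + differ_at u.
    - apply/allP; rewrite /= fcv fca !andTb andbT.
      by apply: (special_fresh_through xc yc); brute.
    move=> c' xc' yc' ac' /=; apply/and4P; split=> //.
    + differ_at a.
    + differ_at x.
    + differ_at x.
  have {}cu : d c u = 1 by move: cu (nx u xu); tri c u x; brute.
  exists [:: L c v; L c a; L x u]; split=> //.
  - apply: uniq3.
    + differ_at a.
    + differ_at y.
    + differ_at v.
  - apply/allP; rewrite /= fcv fca !andTb andbT.
    by apply: (special_fresh_through xc yc); brute.
  move=> c' xc' yc' ac' /=; apply/and4P; split=> //.
  + differ_at a.
  + differ_at x.
  + differ_at x.
have {}cv : d c v = 1 by move: cv (ny v); tri c v y; brute.
have fvy : L v y \in fresh by apply: (special_fresh_through xc yc); brute.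
have [w [wL caw cw2 fcw]] := anchor_missed cQ xa ya Ea.
(* Two different edge lines and [L c w] are enough. If the lines of [v y] and [c a] agree, the edge
   [x u] is tried; if it agrees as well, [w] is off all three, and [L u w] differs from [L c w]
   because [c] and [u] are neighbours of [v]. *)
have [E1|N1] := eqVneq (L v y) (L c a); last first.
  exists [:: L c w; L c a; L v y]; split=> //.
  - apply: uniq3; last by rewrite eq_sym.
      by apply: (neq_set_witness (z := w)); move: wL cw2; brute.
    apply: (neq_set_witness (z := a)); move: cw2; brute.
  - by apply/allP; rewrite /= fcw fca fvy.
  move=> c' xc' yc' ac' /=; apply/and4P; split=> //.
  + by apply: (neq_set_witness (z := a)); move: cw2; brute.
  + differ_at x.
  + differ_at x.
have inE1 z' : (z' \in L v y) = (z' \in L c a) by rewrite E1.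
have cu : d c u = 1 by move: (nx u xu) (inE1 u); tri c u v; brute.
have fxu : L x u \in fresh by apply: (special_fresh_through xc yc); brute.
have [E2|N2] := eqVneq (L x u) (L v y); last first.
  exists [:: L c w; L x u; L v y]; split=> //.
  - apply: uniq3 => //.
      by apply: (neq_set_witness (z := a)); move: cw2; brute.
    by apply: (neq_set_witness (z := a)); move: cw2; brute.
  - by apply/allP; rewrite /= fcw fxu fvy.
  move=> c' xc' yc' ac' /=; apply/and4P; split=> //.
  + by apply: (neq_set_witness (z := a)); move: cw2; brute.
  + differ_at x.
  + differ_at x.
have [vwy xw2 yw2] : [/\ d v w = d y w, 2 <= d x w & 2 <= d y w].
  by apply: special_missed; rewrite E1.
have uwx : d u w = d x w.
  by move: wL; rewrite -E1 -E2; tri x u w; brute.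
have fuw : L u w \in fresh by apply: special_fresh_avoiding; move: uwx xw2 yw2; tri y u w; brute.
have ncuw : L c w != L u w.
  rewrite ![L _ w]mlineC //; apply: (pencil_neq (v := v)) => //.
  - by rewrite (gm_sym M); move: cw2; brute.
  - by rewrite (gm_sym M) uwx.
  - by move=> cu'; move: xu; rewrite -cu' xc.
  by rewrite (gm_sym M).
exists [:: L c w; L u w; L v y]; split=> //.
- apply: uniq3 => //.
    by apply: (neq_set_witness (z := a)); move: cw2; brute.
  by apply: (neq_set_witness (z := w)); move: uwx vwy; brute.
- by apply/allP; rewrite /= fcw fuw fvy.
move=> c' xc' yc' ac' /=; apply/and4P; split=> //.
+ by apply: (neq_set_witness (z := a)); move: cw2; brute.
+ by apply: (neq_set_witness (z := a)); move: uwx xw2 (n3 w) cw2; tri a x w; brute.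
+ differ_at x.
Qed.

Lemma special_outer b : d x b = 3 -> d y b = 1 ->
  exists c, [/\ d x c = 2, d y c = 2 & d b c = 1].
Proof.
have [vy uB uN _ _] := special_facts.
move=> xb yb; have [c bc xc] := gm_prev xb; exists c; split=> //.
have yc1 : d y c <> 1.
  move=> yc; have cv := uB c xc yc; have vb : d v b = 1 by rewrite -cv (gm_sym M).
  by move: yb; rewrite (uN b xb vb) (gm_refl M).
by move: yc1; tri x y b c; brute.
Qed.

Lemma special_outer_next w : d x w = 3 -> d y w = 2 ->
  exists b, [/\ d x b = 3, d y b = 1 & d w b = 1].
Proof.
have [vy uB uN _ _] := special_facts.
move=> xw yw; have [b wb yb] := gm_prev yw; exists b; split=> //.
have xb2 : d x b <> 2.
  move=> xb; have bv := uB b xb yb; have vw : d v w = 1 by rewrite -bv (gm_sym M).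
  by move: yw; rewrite (uN w xw vw) (gm_refl M).
by move: xb2; tri x w b; brute.
Qed.

(** A vertex off [L v y] is far from both poles. Steps towards [y], and finally one towards [x],
    lead from it to type (2, 2). *)
Lemma special_middle : exists c, d x c = 2 /\ d y c = 2.
Proof.
have [vy uB uN n3 Av] := special_facts.
have [w wL] : exists w, w \notin L v y by apply: nouniv; brute.
have [vwy xw yw] := special_missed wL.
have via p : d x p = 3 -> d y p = 2 -> exists c, d x c = 2 /\ d y c = 2.
  move=> xp yp; have [b [xb yb _]] := special_outer_next xp yp.
  by have [c [xc yc _]] := special_outer xb yb; exists c.
have [yw2|yw3] : d y w = 2 \/ d y w = 3 by move: yw; brute.
  have [xw2|xw3] : d x w = 2 \/ d x w = 3 by move: xw; brute.
    by exists w.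
  exact: via xw3 yw2.
have [p wp yp] := gm_prev yw3.
have xp1 : d x p <> 1.
  by move=> xp; move: (Av p xp yp) vwy; tri v w p; brute.
have [xp|xp] : d x p = 2 \/ d x p = 3 by move: xp1 xw; tri x w p; brute.
  by exists p.
exact: via xp yp.
Qed.

Lemma fresh_far c p : d x c = 2 -> d y c = 2 -> 2 <= d c p ->
  2 <= d x p -> 2 <= d y p -> L c p \in fresh.
Proof.
by move=> xc yc cp xp yp; apply: special_fresh_avoiding; move: cp xp yp; brute.
Qed.

Lemma unblockedI c u' v' : d x c = 2 -> d y c = 2 -> d x u' = 1 -> d c u' = 3 ->
  d y v' = 1 -> d c v' = 3 -> c \in unblocked d x y.
Proof.
move=> xc yc xu cu yv cv; rewrite in_setU in_setD in_setU in_sphere2 xc yc andbT.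
apply/orP; left; apply/norP; split; apply/negP.
  by case/blockedP=> z [_ xz Ez]; have [_ _ _ /(_ u' xu)] := eq_lines_2_3 M xc xz Ez.
by case/blockedP=> z [_ xz Ez]; have [_ _ _ /(_ v' yv)] := eq_lines_2_3 M yc xz Ez.
Qed.

Lemma fresh2 (l1 l2 : {set T}) : l1 \in fresh -> l2 \in fresh -> l1 != l2 ->
  2 <= #|fresh|.
Proof.
move=> f1 f2 n12; apply: (@card_ge_uniq _ _ [:: l1; l2]); first by rewrite /= inE n12.
by apply/allP; rewrite /= f1 f2.
Qed.

(** This settles the count when no vertex is doubly blocked. *)
Lemma special_slack : 2 <= #|fresh| + #|unblocked d x y|.
Proof.
have [vy uB uN n3 Av] := special_facts.
have [u [xu yu vu]] := special_inner.
have one1 l c : l \in fresh -> c \in unblocked d x y -> 2 <= #|fresh| + #|unblocked d x y|.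
  by move=> lf cU; rewrite (cardD1 l) lf [X in _ + X](cardD1 c) cU; lia.
suff [[l lf [c cU]]|[l1 [l2 [f1 f2 n12]]]] :
    (exists2 l, l \in fresh & exists c, c \in unblocked d x y) \/
    (exists l1 l2, [/\ l1 \in fresh, l2 \in fresh & l1 != l2]).
- exact: one1 lf cU.
- by apply: leq_trans (fresh2 f1 f2 n12) (leq_addr _ _).
have [|all1] := boolP [exists c, [&& d x c == 2, d y c == 2 & d c v != 1]].
  case/existsP=> c /and3P[/eqP xc /eqP yc cv1].
  have [b cb yb] := gm_prev yc.
  have xb : d x b = 3.
    have xb2 : d x b <> 2 by move=> h; move: cv1; rewrite -(uB b h yb) cb.
    by move: xb2; tri x y b; brute.
  have fcb : L c b \in fresh by apply: (special_fresh_through xc yc); brute.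
  have [cv|cv] : d c v = 2 \/ d c v = 3 by move: cv1; tri x v y c; brute.
    right; exists (L c b), (L c v); split=> //; first by apply: special_fresh_avoiding; brute.
    differ_at x.
  have [cu|cu] : d c u = 2 \/ d c u = 3 by tri c u v; brute.
    right; exists (L c b), (L c u); split=> //; first by apply: special_fresh_avoiding; brute.
    differ_at x.
  (* Here [c] is at distance 3 from a neighbour of each pole, which [eq_lines_2_3] forbids for a
     blocked vertex. *)
  left; exists (L c b) => //; exists c; apply: (unblockedI xc yc xu cu (v' := v)) => //.
  by rewrite (gm_sym M).
(* From here on every vertex of type (2, 2) is adjacent to [v]. *)
have {}all1 c : d x c = 2 -> d y c = 2 -> d c v = 1.
  move=> xc yc; apply/eqP; apply: contraNT all1 => cv.
  by apply/existsP; exists c; rewrite xc yc cv.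
have [c [xc yc]] := special_middle; have cv := all1 c xc yc.
have fvy : L v y \in fresh by apply: (special_fresh_through xc yc); brute.
have [w wL] : exists w, w \notin L v y by apply: nouniv; brute.
have [vwy xw yw] := special_missed wL.
have [cw|cw] := boolP (2 <= d c w).
  right; exists (L v y), (L c w); split=> //; first exact: fresh_far.
  by apply: (neq_set_witness (z := x)); move: cw xw; brute.
have {}cw : d c w = 1.
  move: cw; have : d c w <> 0 by move=> /(gm_sep M) cw; move: vwy; rewrite -cw; brute.
  by brute.
have xw3 : d x w = 3.
  have xw2 : d x w = 2 -> d y w <> 2 by move=> h1 h2; move: (all1 w h1 h2) vwy; brute.
  by move: xw2 vwy xw yw; tri c v w; tri x y w; brute.
have yw2 : d y w = 2 by move: vwy yw; tri c v w; brute.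
(* The vertex [w] has type (3, 2). If it is blocked for [y] by [t], it is the only neighbour of [t]
   at distance 2 from [y]; so [c] is not adjacent to [t], and [L c t] is fresh. *)
have [/blockedP[t [_ yt Et]]|wb] := boolP (w \in blocked y); last first.
  left; exists (L v y) => //; exists w.
  by rewrite in_setU !in_setD wb !in_sphere2 xw3 yw2 orbT.
have [wt ut _ _] := eq_lines_2_3 M yw2 yt Et.
have ct : 2 <= d c t.
  have ct1 : d c t <> 1.
    by move=> ct; have cw' : c = w by [apply: ut => //; rewrite (gm_sym M)]; move: xc; rewrite cw' xw3.
  by move: ct1; tri y c t; brute.
right; exists (L v y), (L c t); split=> //.
  by apply: fresh_far; rewrite ?yt //; tri x w t; brute.
by apply: (neq_set_witness (z := x)); move: ct; tri x w t; brute.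
Qed.
End Special.
End SpecialPair.

(** * Pairs that are special from both ends *)

Section DoublySpecialPair.
Variables (T : finType) (d : T -> T -> nat).
Hypothesis M : graph_metric3 d.
Local Notation L := (mline d).
Hypothesis nouniv : forall p q, 0 < d p q -> exists w, w \notin L p q.
Variables (x y u v : T).
Hypotheses (xy : d x y = 3) (xv : d x v = 2) (Ev : L x v = L x y).
Hypotheses (yu : d y u = 2) (Eu : L y u = L x y).
Local Notation fresh := (fresh d x y (special_base d x y)).

Lemma doubly_special_facts :
  [/\ d u x = 1, d v y = 1, d u v = 1, forall w, d y w = 2 -> d x w = 1 -> w = u &
   forall w, d x w = 1 -> d y w = 3 -> d u w = 2 /\ d v w = 2]
  /\ [/\ forall w, d x w = 2 -> d y w = 1 -> w = v,
   forall w, d x w = 3 -> d y w = 1 -> d u w = 2 /\ d v w = 2,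
   forall w, w \notin L x u -> [/\ d u w = d x w, 2 <= d x w & 2 <= d y w] &
   forall w, w \notin L v y -> [/\ d v w = d y w, 2 <= d x w & 2 <= d y w]].
Proof.
have yx : d y x = 3 by rewrite (gm_sym M).
have Eu' : L y u = L y x by rewrite Eu (mlineC M).
have [vy uB uN n3 Av] := special_facts M xy xv Ev.
have [ux uA uN' n3' Bu] := special_facts M yx yu Eu'.
have uv : d u v = 1 by apply: Bu; rewrite ?(gm_sym M y).
split; split=> //.
- move=> w xw yw; have := n3 w xw; have uw1 : d u w <> 1.
    by move=> uw; move: xw; rewrite (uN' w yw uw) (gm_refl M).
  by move: uw1; tri x u w; tri v y w; tri u y w; brute.
- move=> w xw yw; have := n3' w yw; have vw1 : d v w <> 1.
    by move=> vw; move: yw; rewrite (uN w xw vw) (gm_refl M).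
  by move: vw1; tri v y w; tri u x w; tri v x w; brute.
- move=> w wL; have [] := @special_missed _ _ M _ _ _ yx yu Eu' w; last by move=> ? ? ?; split.
  by rewrite (mlineC M).
by move=> w wL; have [] := @special_missed _ _ M _ _ _ xy xv Ev w wL.
Qed.

(** The base shrinks to [L x y], as [u] is the only vertex of type (1, 2) and [L y u = L x y]. Any
    vertex [w] off [L x y] therefore certifies freshness. *)
Lemma fresh_edge w p q : d x w + d y w <> 3 -> 0 < d p q ->
  x \in L p q -> y \in L p q -> w \in L p q -> L p q \in fresh.
Proof.
move=> wxy pq xl yl wl; rewrite inE (mem_mlines M pq) xl yl eqxx /=.
have nxy : L p q != L x y by apply: (neq_set_witness (z := w)); rewrite wl; move: wxy; tri x y w; brute.
have [[_ _ _ uA _] _] := doubly_special_facts.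
apply: contra nxy; rewrite /special_base in_setU1 => /orP[//|/imsetP[u' + ->]].
by rewrite in_sphere2 => /andP[/eqP xu' /eqP yu']; rewrite (uA u' yu' xu') Eu.
Qed.

Lemma fresh3 (l1 l2 l3 : {set T}) : [&& l1 \in fresh, l2 \in fresh & l3 \in fresh] ->
  l1 != l2 -> l1 != l3 -> l2 != l3 -> 3 <= #|fresh|.
Proof.
move=> /and3P[f1 f2 f3] n12 n13 n23; apply: (@card_ge_uniq _ _ [:: l1; l2; l3]).
  exact: uniq3.
by apply/allP; rewrite /= f1 f2 f3.
Qed.

Lemma doubly_special_slack : 3 <= #|fresh| + #|unblocked d x y|.
Proof.
have [[ux vy uv uA fA'] [uB fB' missX missY]] := doubly_special_facts.
have fnone := @special_fresh_avoiding _ _ M x y xy; have fboth := @special_fresh_through _ _ M x y xy.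
suff [f3|[f2 [c cU]]] : 3 <= #|fresh| \/ 2 <= #|fresh| /\ exists c, c \in unblocked d x y.
- by apply: leq_trans f3 (leq_addr _ _).
- by rewrite [X in _ + X](cardD1 c) cU; lia.
have [|all1] := boolP [exists c, [&& d x c == 2, d y c == 2 & (d c u != 1) || (d c v != 1)]].
  case/existsP=> c /and3P[/eqP xc /eqP yc cuv].
  have exA : d c u <> 1 -> exists a, [/\ d x a = 1, d y a = 3 & d c a = 1].
    move=> cu; have [a ca xa] := gm_prev M xc; exists a; split=> //.
    have ya : d y a <> 2 by move=> ya; case: cu; rewrite -(uA a ya xa).
    by move: ya; tri x y a; brute.
  have exB : d c v <> 1 -> exists b, [/\ d x b = 3, d y b = 1 & d c b = 1].
    move=> cv; have [b cb yb] := gm_prev M yc; exists b; split=> //.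
    have xb : d x b <> 2 by move=> xb; case: cv; rewrite -(uB b xb yb).
    by move: xb; tri x y b; brute.
  have cu123 : [\/ d c u = 1, d c u = 2 | d c u = 3].
    have : d c u <> 0 by move=> /(gm_sep M) cu; move: xc; rewrite cu; brute.
    by move: (gm_le3 M c u); case: (d c u) => [|[|[|[|]]]] // _ _; [apply: Or31|apply: Or32|apply: Or33].
  have cv123 : [\/ d c v = 1, d c v = 2 | d c v = 3].
    have : d c v <> 0 by move=> /(gm_sep M) cv; move: yc; rewrite cv; brute.
    by move: (gm_le3 M c v); case: (d c v) => [|[|[|[|]]]] // _ _; [apply: Or31|apply: Or32|apply: Or33].
  case: cu123 => cu; case: cv123 => cv.
  - by rewrite cu cv in cuv.
  - left; have [|b [xb yb cb]] := exB; first by rewrite cv.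
    have [ub vb] := fB' b xb yb.
    apply: (@fresh3 (L c v) (L x u) (L v y)); try first [differ_at x | differ_at c].
    apply/and3P; split; [apply: fnone | apply: (fboth c) | apply: (@fresh_edge b)]; by brute.
  - by exfalso; tri u v c; brute.
  - left; have [|a [xa ya ca]] := exA; first by rewrite cu.
    have [ua va] := fA' a xa ya.
    apply: (@fresh3 (L c u) (L x u) (L v y)); try first [differ_at x | differ_at c].
    apply/and3P; split; [apply: fnone | apply: (@fresh_edge a) | apply: (fboth c)]; by brute.
  - left; have [|a [xa ya ca]] := exA; first by rewrite cu.
    apply: (@fresh3 (L c u) (L c v) (L c a)); try first [differ_at x | differ_at v].
    apply/and3P; split; [apply: fnone | apply: fnone | apply: (fboth c)]; by brute.
  - left; have [|a [xa ya ca]] := exA; first by rewrite cu.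
    have [ua va] := fA' a xa ya.
    apply: (@fresh3 (L c u) (L x u) (L v y)); try first [differ_at x | differ_at c].
    apply/and3P; split; [apply: fnone | apply: (@fresh_edge a) | apply: (fboth c)]; by brute.
  - by exfalso; tri u v c; brute.
  - left; have [|b [xb yb cb]] := exB; first by rewrite cv.
    have [ub vb] := fB' b xb yb.
    apply: (@fresh3 (L c v) (L x u) (L v y)); try first [differ_at x | differ_at c].
    apply/and3P; split; [apply: fnone | apply: (fboth c) | apply: (@fresh_edge b)]; by brute.
  (* Now [c] is at distance 3 from both [u] and [v], so it is unblocked. One fresh line is [L x u];
     the other joins [c] to the middle vertex [c'] of a path from [v] to [a]. *)
  right; split; last first.
    by exists c; apply: (unblockedI M xc yc (u' := u) (v' := v)) => //; rewrite (gm_sym M).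
  have [|a [xa ya ca]] := exA; first by rewrite cu.
  have [ua va] := fA' a xa ya; have [c' vc' ac'] := gm_split M va.
  have xc' : d x c' = 2.
    have xc1 : d x c' <> 1.
      move=> xc'; have yc' : d y c' = 2 by tri y v c'; tri y a c'; brute.
      by move: ua; rewrite -(uA c' yc' xc') ac'.
    by move: xc1; tri x a c'; tri x v c'; brute.
  have yc' : d y c' = 2 by tri y v c'; tri y a c'; brute.
  apply: (@fresh2 _ _ _ _ (L c c') (L x u)); last by apply: (neq_set_witness (z := x)); tri v c c'; brute.
    by apply: fnone; tri v c c'; brute.
  by apply: (fboth c); brute.
have {}all1 c : d x c = 2 -> d y c = 2 -> d u c = 1 /\ d v c = 1.
  move=> xc yc; rewrite ![d _ c](gm_sym M).
  have: (d c u == 1) && (d c v == 1).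
    apply: contraNT all1; rewrite negb_and => cuv.
    by apply/existsP; exists c; rewrite xc yc cuv.
  by case/andP=> /eqP -> /eqP ->.
have [c [xc yc]] := special_middle M nouniv xy xv Ev; have [uc vc] := all1 c xc yc.
have fxu : L x u \in fresh by apply: (fboth c); brute.
have fvy : L v y \in fresh by apply: (fboth c); brute.
left; have [w wX] : exists w, w \notin L x u by apply: nouniv; brute.
have [uw xw yw] := missX w wX.
have fuw : L u w \in fresh by apply: fnone; move: uw xw yw; tri y u w; brute.
(* If the two edge lines agree, [w] is off both, and the lines from [u] and [v] to [w] differ
   because [c] is a common neighbour of [u] and [v]. *)
have [E|N] := eqVneq (L x u) (L v y); last first.
  apply: (@fresh3 (L u w) (L x u) (L v y)) => //; first by rewrite fuw fxu fvy.
    by apply: (neq_set_witness (z := w)); move: uw xw; brute.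
  by apply: (neq_set_witness (z := x)); move: uw xw; brute.
have [vw _ _] : [/\ d v w = d y w, 2 <= d x w & 2 <= d y w] by apply: missY; rewrite -E.
have fvw : L v w \in fresh by apply: fnone; move: vw xw yw; tri x v w; brute.
apply: (@fresh3 (L u w) (L v w) (L x u)); first by rewrite fuw fvw fxu.
- rewrite ![L _ w](mlineC M) //; apply: (pencil_neq M (v := c)); rewrite ?(gm_sym M c) ?(gm_sym M w) ?uw ?vw //.
  by move=> E'; move: uv; rewrite E' (gm_refl M).
- by apply: (neq_set_witness (z := w)); move: uw xw; brute.
by apply: (neq_set_witness (z := w)); rewrite (negPf wX); brute.
Qed.

Lemma doubly_special_blocked c :
  c \in doubly_blocked d x y -> #|doubly_blocked d x y| + 3 <= #|fresh|.
Proof.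
have [[ux vy uv uA fA'] [uB fB' missX missY]] := doubly_special_facts.
have fnone := @special_fresh_avoiding _ _ M x y xy; have fboth := @special_fresh_through _ _ M x y xy.
move=> cQ; have [a [z [[xc yc xa ya Ea] xz Ez]]] := doubly_blockedP cQ.
(* One more line than in [special_doubly_blocked] is required. *)
suff [t [ut tf tneq st]]: exists t : seq {set T}, [/\ uniq t, {subset t <= fresh},
    forall c', d x c' = 2 -> d y c' = 2 -> d a c' = 2 -> all (fun l => L a c' != l) t
    & size t = 4].
  by have := anchor_lines M xy cQ xa ya Ea ut tf tneq; rewrite st; lia.
have [w0 [wL caw cw fcw]] := anchor_missed M nouniv xy cQ xa ya Ea.
have [ca _ _ ny] := eq_lines_2_3 M yc ya Ea; have [_ _ _ nx] := eq_lines_2_3 M xc xz Ez.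
have [ua va] := fA' a xa ya.
have fca : L c a \in fresh by apply: (fboth c); brute.
have cu12 : d c u = 1 \/ d c u = 2.
  have xu : d x u = 1 by rewrite (gm_sym M).
  by move: (nx u xu); tri x c u; brute.
have cv12 : d c v = 1 \/ d c v = 2.
  have yv : d y v = 1 by rewrite (gm_sym M).
  by move: (ny v yv); tri y c v; brute.
case: cu12 => cu; case: cv12 => cv; first last.
- exists [:: L c u; L c v; L c a; L x u]; split=> //.
  + by apply: uniq4; [differ_at v | differ_at x | differ_at x | differ_at x | differ_at x | differ_at c].
  + apply/allP; rewrite /= fca; apply/and5P; split=> //.
    * by apply: fnone; brute.
    * by apply: fnone; brute.
    by apply: (@fresh_edge a); brute.
  by move=> c' xc' yc' ac' /=; apply/and5P; split=> //; [differ_at a | differ_at a | differ_at x | differ_at x].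
- exists [:: L c u; L x u; L v y; L c a]; split=> //.
  + by apply: uniq4; [differ_at x | differ_at x | differ_at x | differ_at c | differ_at c | differ_at u].
  + apply/allP; rewrite /= fca; apply/and5P; split=> //.
    * by apply: fnone; brute.
    * by apply: (@fresh_edge a); brute.
    by apply: (fboth c); brute.
  by move=> c' xc' yc' ac' /=; apply/and5P; split=> //; [differ_at a | differ_at x | differ_at x | differ_at x].
- exists [:: L c v; L x u; L v y; L c a]; split=> //.
  + by apply: uniq4; [differ_at x | differ_at x | differ_at x | differ_at c | differ_at v | differ_at c].
  + apply/allP; rewrite /= fca; apply/and5P; split=> //.
    * by apply: fnone; brute.
    * by apply: (fboth c); brute.
    by apply: (@fresh_edge a); brute.
  by move=> c' xc' yc' ac' /=; apply/and5P; split=> //; [differ_at a | differ_at x | differ_at x | differ_at x].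
(* Remaining case: [c] is adjacent to [u] and [v]. The edges [c a], [x u], [v y] all give fresh
   lines; when some of these agree, a vertex off the shared line, joined to [c], [u] or [v], makes
   up for it. *)
have fxu : L x u \in fresh by apply: (fboth c); brute.
have fvy : L v y \in fresh by apply: (fboth c); brute.
have uvN : u <> v by move=> E; move: uv; rewrite E (gm_refl M).
have cuN : c <> u by move=> E; move: cu; rewrite E (gm_refl M).
have cvN : c <> v by move=> E; move: cv; rewrite E (gm_refl M).
have fuw w : w \notin L x u -> L u w \in fresh /\ x \notin L u w.
  move=> wX; have [uw xw yw] := missX w wX; have xl : x \notin L u w by move: uw xw; brute.
  by split=> //; apply: fnone => //; move: uw xw yw; tri y u w; brute.
have fvw w : w \notin L v y -> L v w \in fresh /\ x \notin L v w.
  move=> wY; have [vw xw yw] := missY w wY.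
  have xl : x \notin L v w by move: vw xw yw; tri x v w; brute.
  by split=> //; apply: fnone => //; move: vw xw yw; tri x v w; brute.
have pencil w v' p q : 2 <= d p w -> 2 <= d q w -> p <> q -> d p v' = 1 -> d q v' = 1 -> L p w != L q w.
  move=> pw qw pq pv qv; rewrite ![L _ w](mlineC M) //.
  by apply: (pencil_neq M (v := v')); rewrite // (gm_sym M).
have tc c' : d x c' = 2 -> d y c' = 2 -> d a c' = 2 -> L a c' != L c w0.
  by move=> xc' yc' ac'; apply: (neq_set_witness (z := a)); move: cw; rewrite caw; brute.
have tu c' w : d x c' = 2 -> d y c' = 2 -> d a c' = 2 -> L a c' != L u w.
  by move=> xc' yc' ac'; apply: (neq_set_witness (z := u)); tri x c' u; brute.
have tv c' w : d x c' = 2 -> d y c' = 2 -> d a c' = 2 -> L a c' != L v w.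
  by move=> xc' yc' ac'; apply: (neq_set_witness (z := v)); tri y c' v; brute.
have tx c' p q : d x c' = 2 -> d y c' = 2 -> d a c' = 2 -> x \in L p q -> L a c' != L p q.
  by move=> xc' yc' ac' xl; apply: (neq_set_witness (z := x)); rewrite xl; brute.
have cw2 : 2 <= d c w0 by move: cw; brute.
have xX : x \in L x u by brute.
have xY : x \in L v y by brute.
have xA : x \in L c a by brute.
have nfar (l1 l2 : {set T}) : x \notin l1 -> x \in l2 -> l1 != l2.
  by move=> x1 x2; apply: (neq_set_witness (z := x)); rewrite x2 (negPf x1).
have x0 : x \notin L c w0.
  by case: cw => h; have aw := h; rewrite caw in aw; tri x a w0; brute.
have [EXY|NXY] := eqVneq (L x u) (L v y).
  have [w wX] : exists w, w \notin L x u by apply: nouniv; brute.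
  have wY : w \notin L v y by rewrite -EXY.
  have [EX|NX] := eqVneq (L c a) (L x u).
    have w0X : w0 \notin L x u by rewrite -EX.
    have w0Y : w0 \notin L v y by rewrite -EXY.
    have [fu xu'] := fuw w0 w0X; have [fv xv'] := fvw w0 w0Y.
    have [uw _ _] := missX w0 w0X; have [vw xw yw] := missY w0 w0Y.
    exists [:: L c w0; L u w0; L v w0; L x u]; split=> //.
    + apply: uniq4; try exact: nfar.
      * by apply: (pencil _ v) => //; rewrite ?uw //; brute.
      * by apply: (pencil _ u) => //; rewrite ?vw //; brute.
      by apply: (pencil _ c); rewrite ?uw ?vw //; brute.
    + by apply/allP; rewrite /= fcw fu fv fxu.
    by move=> c' xc' yc' ac' /=; rewrite tc ?tu ?tv ?tx.
  have [fu xu'] := fuw w wX; have [fv xv'] := fvw w wY.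
  have [uw _ _] := missX w wX; have [vw xw yw] := missY w wY.
  exists [:: L u w; L v w; L x u; L c a]; split=> //.
  + apply: uniq4; try exact: nfar; last by rewrite eq_sym.
    by apply: (pencil _ c); rewrite ?uw ?vw //; brute.
  + by apply/allP; rewrite /= fu fv fxu fca.
  by move=> c' xc' yc' ac' /=; rewrite tu ?tv ?tx.
have [EX|NX] := eqVneq (L c a) (L x u).
  have w0X : w0 \notin L x u by rewrite -EX.
  have [fu xu'] := fuw w0 w0X; have [uw xw yw] := missX w0 w0X.
  exists [:: L c w0; L u w0; L x u; L v y]; split=> //.
  + apply: uniq4; try exact: nfar; last by [].
    by apply: (pencil _ v) => //; rewrite ?uw //; brute.
  + by apply/allP; rewrite /= fcw fu fxu fvy.
  by move=> c' xc' yc' ac' /=; rewrite tc ?tu ?tx.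
have [EY|NY] := eqVneq (L c a) (L v y).
  have w0Y : w0 \notin L v y by rewrite -EY.
  have [fv xv'] := fvw w0 w0Y; have [vw xw yw] := missY w0 w0Y.
  exists [:: L c w0; L v w0; L x u; L v y]; split=> //.
  + apply: uniq4; try exact: nfar; last by [].
    by apply: (pencil _ u) => //; rewrite ?vw //; brute.
  + by apply/allP; rewrite /= fcw fv fxu fvy.
  by move=> c' xc' yc' ac' /=; rewrite tc ?tv ?tx.
exists [:: L c w0; L c a; L x u; L v y]; split=> //.
+ by apply: uniq4; try exact: nfar.
+ by apply/allP; rewrite /= fcw fca fxu fvy.
by move=> c' xc' yc' ac' /=; rewrite tc ?tx.
Qed.
End DoublySpecialPair.

Section PlainPair.
Variables (T : finType) (d : T -> T -> nat).
Hypothesis M : graph_metric3 d.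
Local Notation L := (mline d).
Local Notation sphere2 := (sphere2 d).
Hypothesis nouniv : forall p q, 0 < d p q -> exists w, w \notin L p q.

(** After [card_lines_ge] and [card_blocked], fresh lines and unblocked vertices together must
    exceed the doubly blocked ones by 2. If the pair is also special from [y], the base has one line
    less and the excess must be 3. *)
Lemma special_lines x y v :
  d x y = 3 -> d x v = 2 -> L x v = L x y -> #|T| <= #|mlines d|.
Proof.
move=> xy xv Ev; have [vy uB _ _ _] := special_facts M xy xv Ev.
have sub : special_base d x y \subset mlines d.
  apply/subsetP => l; rewrite /special_base in_setU1 => /orP[/eqP ->|/imsetP[u + ->]].
    by apply: (mem_mlines M); brute.
  by rewrite in_sphere2 => /andP[/eqP xu /eqP yu]; apply: (mem_mlines M); brute.
have := card_lines_ge M xy sub (special_base_mem M xy); have := card_blocked M xy.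
have B1 : #|sphere2 x y 2 1| <= 1.
  rewrite -[X in _ <= X](cards1 v); apply/subset_leq_card/subsetP => b.
  by rewrite in_sphere2 inE => /andP[/eqP xb /eqP yb]; rewrite (uB b xb yb).
have Q0 : #|doubly_blocked d x y| = 0 \/ exists c, c \in doubly_blocked d x y.
  by have [->|[c cQ]] := set_0Vmem (doubly_blocked d x y); [left; rewrite cards0|right; exists c].
have [/existsP[u /andP[/eqP yu /eqP Eu]]|nu] := boolP [exists u, (d y u == 2) && (L y u == L x y)].
  have A1 : #|sphere2 x y 1 2| <= 1.
    have [[_ _ _ uA _] _] := doubly_special_facts M xy xv Ev yu Eu.
    rewrite -[X in _ <= X](cards1 u); apply/subset_leq_card/subsetP => a.
    by rewrite in_sphere2 inE => /andP[/eqP xa /eqP ya]; rewrite (uA a ya xa).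
  have S1 : 0 < #|special_base d x y| by rewrite (cardD1 (L x y)) setU11.
  have := doubly_special_slack M nouniv xy xv Ev yu Eu.
  by case: Q0 => [Q0|[c /(doubly_special_blocked M nouniv xy xv Ev yu Eu)]];
    move: S1; rewrite /reverse_coercion; lia.
have S1 : #|special_base d x y| = 1 + #|sphere2 x y 1 2|.
  rewrite cardsU1; congr (_ + _); last first.
    apply: card_in_imset => p q; rewrite !in_sphere2 => /andP[_ /eqP yp] /andP[_ /eqP yq].
    by apply: (mline_inj M); rewrite yp // yq.
  case: imsetP => // -[u + Eu]; rewrite in_sphere2 => /andP[_ yu].
  by case/existsP: nu; exists u; rewrite yu Eu eqxx.
have := special_slack M nouniv xy xv Ev.
by case: Q0 => [Q0|[c /(special_doubly_blocked M nouniv xy xv Ev)]];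
  move: S1; rewrite /reverse_coercion; lia.
Qed.

(** * Pairs without coincidences *)

Section Plain.
Variables (x y : T).
Hypothesis xy : d x y = 3.

(** On [L y u] only [u] is at distance 2 from [y], so the middle vertex of a shortest path from [x]
    to [v] is [u]. Likewise only [v] is at distance 2 from [x], and any other point of the line is a
    pole. *)
Lemma twin_facts u v : d x u = 1 -> d y u = 2 -> d x v = 2 -> d y v = 1 ->
  L x v = L y u ->
  d u v = 1 /\ forall w, w \in L x v -> [\/ w = x, w = u, w = v | w = y].
Proof.
move=> xu yu xv yv E; have Ew w : (w \in L x v) = (w \in L y u) by rewrite E.
have uy w : d y w = 2 -> w \in L x v -> w = u.
  by move=> yw wl; apply: (gm_sep M); move: wl; rewrite Ew; tri y u w; brute.
have uv : d u v = 1.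
  have [c xc cv] := gm_split M xv.
  have yc : d y c = 2 by tri x y c; tri y c v; brute.
  have cu : c = u by apply: uy => //; brute.
  by rewrite -cu.
split=> // w wl; have wl' := wl; rewrite Ew in wl'.
have [xw|xw] := eqVneq (d x w) 2.
  by apply: Or43; apply: (gm_sep M); move: wl; tri x v w; brute.
have [yw|yw] := eqVneq (d y w) 2; first by apply: Or42; apply: uy.
have [h|h] : d x w = 0 \/ d y w = 0.
  by move: xw yw wl wl'; tri x y u v w; brute.
  by apply: Or41; rewrite (gm_sep M h).
by apply: Or44; rewrite (gm_sep M h).
Qed.

Definition plain_base x y :=
  L x y |: ([set L x v | v in sphere2 x y 2 1] :|: [set L y u | u in sphere2 x y 1 2]).

Lemma plain_base_mem l : l \in plain_base x y -> (x \in l) && (y \in l).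
Proof.
rewrite in_setU1 in_setU => /or3P[/eqP ->|/imsetP[v + ->]|/imsetP[u + ->]]; first by brute.
  by rewrite in_sphere2 => /andP[/eqP xv /eqP yv]; brute.
by rewrite in_sphere2 => /andP[/eqP xu /eqP yu]; brute.
Qed.

Lemma plain_fresh_avoiding p q : 0 < d p q -> x \notin L p q -> y \notin L p q ->
  L p q \in fresh d x y (plain_base x y).
Proof. by apply: fresh_avoiding => // l /plain_base_mem/andP[]. Qed.

(** A base line [L x v'] through [v] has [v' = v], both being at distance 2 from [x]; similarly for
    [u]. *)
Lemma plain_not_fresh u v p q : d x u = 1 -> d y u = 2 -> d x v = 2 -> d y v = 1 ->
  0 < d p q -> [&& x \in L p q, y \in L p q, u \in L p q & v \in L p q] ->
  L p q \notin fresh d x y (plain_base x y) ->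
  [\/ L p q = L x y, L p q = L x v | L p q = L y u].
Proof.
move=> xu yu xv yv pq /and4P[xl yl ul vl].
rewrite inE (mem_mlines M pq) xl yl eqxx /= negbK in_setU1 in_setU.
case/or3P=> [/eqP|/imsetP[v']|/imsetP[u']]; first by move=> ->; apply: Or31.
  rewrite in_sphere2 => /andP[/eqP xv' /eqP yv'] E; apply: Or32.
  by rewrite E; congr (L x _); apply: (gm_sep M); move: vl; rewrite E; tri x v v'; brute.
rewrite in_sphere2 => /andP[/eqP xu' /eqP yu'] E; apply: Or33.
by rewrite E; congr (L y _); apply: (gm_sep M); move: ul; rewrite E; tri y u u'; brute.
Qed.
End Plain.

Lemma plain_baseC x y : plain_base y x = plain_base x y.
Proof.
have S i j : sphere2 y x i j = sphere2 x y j i.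
  by apply/setP => z; rewrite !in_sphere2 andbC.
by rewrite /plain_base (mlineC M y x) !S [X in _ |: X = _]setUC.
Qed.

Lemma freshC x y : fresh d y x (plain_base y x) = fresh d x y (plain_base x y).
Proof. by rewrite plain_baseC; apply/setP => l; rewrite !inE [(y \in l) == _]eq_sym. Qed.

Local Notation fresh x y := (fresh d x y (plain_base x y)).

(** * Pairs with no vertex far from both ends *)

Section Covered.
Variables (x y : T).
Hypothesis xy : d x y = 3.
Hypothesis cover : forall w, 2 <= d x w -> d y w <= 1.

Lemma cover_cases w :
  (w = x \/ w = y) \/
  [\/ d x w = 1 /\ d y w = 2, d x w = 2 /\ d y w = 1,
      d x w = 1 /\ d y w = 3 | d x w = 3 /\ d y w = 1].
Proof.
have c := cover (w := w).
have [h|h] : d x w = 0 \/ 0 < d x w by case: (d x w) => [|n]; [left|right].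
  by left; left; rewrite (gm_sep M h).
have [h'|h'] : d y w = 0 \/ 0 < d y w by case: (d y w) => [|n]; [left|right].
  by left; right; rewrite (gm_sep M h').
have H : (d x w == 1) && (d y w == 2) || (d x w == 2) && (d y w == 1) ||
   (d x w == 1) && (d y w == 3) || (d x w == 3) && (d y w == 1).
  by move: c h h'; tri x y w; brute.
right; case/orP: H => [/orP[/orP[]|]|] /andP[/eqP ? /eqP ?];
  by [apply: Or41|apply: Or42|apply: Or43|apply: Or44].
Qed.


Lemma untwinned_fresh_aux :
  (forall u v, d x u = 1 -> d y u = 2 -> d x v = 2 -> d y v = 1 -> L x v <> L y u) ->
  (forall l, l \notin fresh x y) -> forall t, d x t = 1 -> d y t <> 3.
Proof.
move=> ntw nf t xt yt.
have indep p q : d x p = d x q -> d y p = d y q -> 0 < d x p -> 0 < d y p -> d p q <> 1.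
  move=> xpq ypq xp yp pq; have /negP[] := nf (L p q).
  by apply: plain_fresh_avoiding => //; move: xpq ypq xp yp; brute.
have AB p q : d x p = 1 -> d y p = 2 -> d x q = 2 -> d y q = 1 -> d p q <> 2.
  move=> xp yp xq yq pq; have /negP[] := nf (L p q).
  by apply: plain_fresh_avoiding => //; brute.
have [u tu yu] := gm_prev M yt.
have xu : d x u = 1 by have := cover (w := u); tri x t u; tri x y u; brute.
have [v uv vy] := gm_split M (eq_trans (gm_sym M u y) yu).
have yv : d y v = 1 by rewrite (gm_sym M).
have xv : d x v = 2 by tri x u v; tri x y v; brute.
have tv : d t v = 2 by tri t u v; tri t y v; brute.
have Aodd a : d x a = 1 -> d y a = 2 -> d v a = 1 \/ d v a = 3.
  by move=> xa ya; have := AB a v xa ya xv yv; tri y a v; brute.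
have Bodd b : d x b = 2 -> d y b = 1 -> d u b = 1 \/ d u b = 3.
  by move=> xb yb; have := AB u b xu yu xb yb; tri x u b; brute.
have Bv b : d x b = 2 -> d y b = 1 -> b = v \/ d v b = 2.
  move=> xb yb; have [vb|vb] := eqVneq (d v b) 0; first by left; rewrite (gm_sep M vb).
  have := @indep v b; rewrite xv yv xb yb => /(_ erefl erefl isT isT) vb1.
  by right; move: vb vb1; tri y v b; brute.
(* The line of the edge [v y] contains [t], unlike [L x y] and [L x v]. *)
have E1 : L v y = L y u.
  have [||E|E|//] := plain_not_fresh xu yu xv yv _ _ (nf (L v y)); try by brute.
    by exfalso; have: t \in L v y; [brute | rewrite E; brute].
  by exfalso; have: t \in L v y; [brute | rewrite E; brute].
have uA a : d x a = 1 -> d y a = 2 -> a = u.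
  move=> xa ya; apply: (gm_sep M).
  have: a \in L v y by case: (Aodd a xa ya) => va; brute.
  by rewrite E1; tri y a u; brute.
have uA' t' : d x t' = 1 -> d y t' = 3 -> d u t' = 1.
  move=> xt' yt'; have [p tp yp] := gm_prev M yt'.
  suff <- : p = u by rewrite (gm_sym M).
  by apply: uA => //; have := cover (w := p); tri x t' p; tri x y p; brute.
(* Such a [w] can only have type (2, 1) or (3, 1); this is refuted for each base line that [L x u]
   may equal. *)
have [w wL] : exists w, w \notin L u v by apply: nouniv; brute.
have wA' : ~ (d x w = 1 /\ d y w = 3).
  by move=> [xw yw]; have := uA' w xw yw; move: wL; tri v u w; tri v y w; brute.
have wA : ~ (d x w = 1 /\ d y w = 2).
  by move=> [xw yw]; move: wL; rewrite (uA w xw yw); brute.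
have wxy : ~ (w = x \/ w = y) by move=> [E|E]; move: wL; rewrite E; brute.
have [||E2|E2|E2] := plain_not_fresh xu yu xv yv _ _ (nf (L x u)); try by brute.
- case: (cover_cases w) => // -[] // [xw yw].
    by case: (Bv w xw yw) (Bodd w xw yw) wL => [->|vw] [uw|uw]; brute.
  have wn : w \notin L x u by rewrite E2; brute.
  by move: wL wn; tri v y w; tri x u w; tri u v w; brute.
- have uB b : d x b = 2 -> d y b = 1 -> b = v.
    move=> xb yb; apply: (gm_sep M).
    have: b \in L x u by case: (Bodd b xb yb) => ub; brute.
    by rewrite E2; tri x b v; brute.
  case: (cover_cases w) => // -[] // [xw yw].
    by move: wL; rewrite (uB w xw yw); brute.
  have [p wp xp] := gm_prev M xw.
  have pv : p = v by apply: uB => //; have := cover (w := p); tri x y p; brute.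
  by move: wL wp; rewrite pv; tri x u w; tri u v w; brute.
by exfalso; have: t \in L y u; [have := uA' t xt yt; brute | rewrite -E2; have := uA' t xt yt; brute].
Qed.

End Covered.

Lemma untwinned_fresh x y : d x y = 3 -> (forall w, 2 <= d x w -> d y w <= 1) ->
  (forall u v, d x u = 1 -> d y u = 2 -> d x v = 2 -> d y v = 1 -> L x v <> L y u) ->
  exists l, l \in fresh x y.
Proof.
move=> xy cov ntw; have yx : d y x = 3 by rewrite (gm_sym M).
have [|nf] := boolP [exists l, l \in fresh x y]; first by case/existsP=> l lf; exists l.
have {}nf l : l \notin fresh x y by apply: contra nf => lf; apply/existsP; exists l.
have A'0 := untwinned_fresh_aux xy cov ntw nf.
have B'0 : forall t, d y t = 1 -> d x t <> 3.
  apply: (untwinned_fresh_aux yx).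
  - by move=> w yw; have := cov w; move: yw; brute.
  - by move=> u v yu xu yv xv E; apply: (ntw v u).
  - by move=> l; rewrite freshC.
(* Only types (1, 2) and (2, 1) are left besides the poles, and none of these vertices can be off
   [L x u]. *)
exfalso; have [u xu uy] := gm_split M xy.
have yu : d y u = 2 by rewrite (gm_sym M).
have indep p q : d x p = d x q -> d y p = d y q -> 0 < d x p -> 0 < d y p -> d p q <> 1.
  move=> xpq ypq xp yp pq; have /negP[] := nf (L p q).
  by apply: plain_fresh_avoiding => //; move: xpq ypq xp yp; brute.
have [w wL] : exists w, w \notin L x u by apply: nouniv; brute.
have [[E|E]|[] [xw yw]] := cover_cases xy cov w.
- by move: wL; rewrite E; brute.
- by move: wL; rewrite E; brute.
- by have := @indep u w; rewrite xu yu xw yw => /(_ erefl erefl isT isT); move: wL; tri x u w; brute.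
- have uw : d u w <> 2.
    move=> uw; have /negP[] := nf (L u w).
    by apply: plain_fresh_avoiding => //; brute.
  by move: uw wL; tri x u w; brute.
- exact: A'0 w xw yw.
exact: B'0 w yw xw.
Qed.
End PlainPair.

(** * Coincidences between lines from the two ends *)

Section Twins.
Variables (T : finType) (d : T -> T -> nat).
Hypothesis M : graph_metric3 d.
Local Notation L := (mline d).
Local Notation blocked := (blocked d).
Local Notation sphere2 := (sphere2 d).
Hypothesis nouniv : forall p q, 0 < d p q -> exists w, w \notin L p q.
Local Notation fresh x y := (fresh d x y (plain_base d x y)).

Definition twins x y u v :=
  [/\ d x u = 1, d y u = 2, d x v = 2, d y v = 1 & L x v = L y u].

Lemma twinsC x y u v : twins x y u v -> twins y x v u.
Proof. by case. Qed.

Lemma twins_far x y u v w : d x y = 3 -> twins x y u v -> d x w + d y w <> 3 \/ w <> u /\ w <> v ->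
  0 < d x w -> 0 < d y w -> w \notin L x v.
Proof.
move=> xy [xu yu xv yv E] h xw yw; have [uv tw] := twin_facts M xy xu yu xv yv E.
apply/negP => /tw[] wE; move: h xw yw; rewrite wE ?(gm_refl M) //.
- by move=> [|[]//]; brute.
- by move=> [|[]//]; brute.
Qed.

(** At distance 1 or 3 from [v], the vertex [a] would lie on [L x v], which is just the path [x],
    [u], [v], [y]. *)
Lemma twins_inner x y u v a : d x y = 3 -> twins x y u v ->
  d x a = 1 -> d y a = 2 -> a <> u -> d v a = 2.
Proof.
move=> xy tw xa ya au; have [xu yu xv yv E] := tw.
have av : a <> v by move=> e; move: xa; rewrite e; brute.
have := @twins_far x y u v a xy tw (or_intror (conj au av)).
by rewrite xa ya => /(_ isT isT); tri x v a; tri y v a; brute.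
Qed.

Lemma twins_edge x y u v a : d x y = 3 -> (forall w, 2 <= d x w -> d y w <= 1) ->
  twins x y u v -> d x a = 1 -> d y a = 2 -> a <> u ->
  exists2 l, l \in fresh x y & (x \in l) && (y \in l).
Proof.
move=> xy cov tw xa ya au; have [xu yu xv yv E] := tw.
have [uv _] := twin_facts M xy xu yu xv yv E.
have [/existsP[l /andP[lf lxy]]|nf] := boolP [exists l, (l \in fresh x y) && ((x \in l) && (y \in l))].
  by exists l.
exfalso; have {}nf p q : x \in L p q -> y \in L p q -> L p q \notin fresh x y.
  move=> xl yl; apply: contra nf => lf; apply/existsP; exists (L p q).
  by rewrite lf xl yl.
have far := twins_far xy tw.
have va := twins_inner xy tw xa ya au.
have E1 : L v y = L x v.
  have [||||E1|//|->//] := plain_not_fresh M xu yu xv yv _ _ (nf v y _ _); try by brute.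
  by exfalso; have: a \in L x y; [brute | rewrite -E1; brute].
have A'0 t : d x t = 1 -> d y t <> 3.
  move=> xt yt; have tN : t \notin L x v by apply: far; [left | |]; brute.
  by have := tN; rewrite -E1; move: tN; tri x v t; brute.
have vB b : d x b = 2 \/ d x b = 3 -> d y b = 1 -> b <> v -> d v b = 1.
  move=> xb yb bv; have bN : b \notin L x v.
    have bu : b <> u by move=> e; move: yb; rewrite e; brute.
    by apply: far; [right | move: xb; brute | brute].
  by move: bN; rewrite -E1; tri v y b; brute.
have B'0 b : d x b = 3 -> d y b <> 1.
  move=> xb yb; have bN : b \notin L x v by apply: far; [left | |]; brute.
  have ub : d u b = 2 by move: bN; rewrite E; tri y u b; tri x u b; brute.
  have [||||E2|E2|E2] := plain_not_fresh M xu yu xv yv _ _ (nf x u _ _); try by brute.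
  - by have: b \in L x u; [brute | rewrite E2; brute].
  - by have: b \in L x u; [brute | rewrite E2 (negPf bN)].
  by have: b \in L x u; [brute | rewrite E2 -E (negPf bN)].
have uB b : d x b = 2 -> d y b = 1 -> b <> v -> d u b = 2.
  move=> xb yb bv; have yx : d y x = 3 by rewrite (gm_sym M).
  exact: (twins_inner yx (twinsC tw)).
(* Types (1, 3) and (3, 1) are now excluded. In the first case no vertex can be off [L x u]; in the
   second none can be off [L u v]. *)
have [E2|E2] : L x u = L x y \/ L x u = L x v.
  have [||||E2|E2|E2] := plain_not_fresh M xu yu xv yv _ _ (nf x u _ _); try by brute.
  - by left.
  - by right.
  by right; rewrite E2.
- have [w wL] : exists w, w \notin L x u by apply: nouniv; brute.
  have [[e|e]|[] [xw yw]] := cover_cases M xy cov w.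
  + by move: wL; rewrite e; brute.
  + by move: wL; rewrite e; brute.
  + by move: wL; rewrite E2; brute.
  + by move: wL; rewrite E2; brute.
  + exact: A'0 w xw yw.
  exact: B'0 w xw yw.
have [w wL] : exists w, w \notin L u v by apply: nouniv; brute.
have [[e|e]|[] [xw yw]] := cover_cases M xy cov w.
+ by move: wL; rewrite e; brute.
+ by move: wL; rewrite e; brute.
+ have wu : w <> u by move=> e; move: wL; rewrite e; brute.
  have wN : w \notin L x u.
    have wv : w <> v by move=> e; move: xw; rewrite e; brute.
    by rewrite E2; apply: far; [right | brute | brute].
  by have := twins_inner xy tw xw yw wu; move: wL wN; tri x u w; brute.
+ have wv : w <> v by move=> e; move: wL; rewrite e; brute.
  by have := vB w (or_introl xw) yw wv; have := uB w xw yw wv; move: wL; brute.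
+ exact: A'0 w xw yw.
exact: B'0 w xw yw.
Qed.

Lemma in_remote x y z : d x y = 3 ->
  (z \in offside d x y :&: offside d y x) = (2 <= d x z) && (2 <= d y z).
Proof. by move=> xy; rewrite !inE; tri x y z; brute. Qed.

(** The lines from [v] to the vertices of type (1, 2) other than [u] avoid both poles; the successor
    accounts for [u]. *)
Lemma twins_pencil x y u v (t : seq {set T}) : d x y = 3 -> twins x y u v ->
  uniq t -> {subset t <= fresh x y} ->
  (forall p, d x p = 1 -> d y p = 2 -> d v p = 2 -> all (fun l => L v p != l) t) ->
  #|sphere2 x y 1 2| + size t <= #|fresh x y|.+1.
Proof.
move=> xy tw ut tf tN; have [xu yu xv yv E] := tw.
have uA : u \in sphere2 x y 1 2 by rewrite in_sphere2 xu yu.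
rewrite (cardsD1 u) uA add1n addSn ltnS; apply: (card_pencil M (c := v)) => // p.
  rewrite in_setD1 in_sphere2 => /and3P[/eqP pu /eqP xp /eqP yp].
  have vp := twins_inner xy tw xp yp pu; split=> //.
  by apply: (plain_fresh_avoiding M xy); brute.
rewrite in_setD1 in_sphere2 => /and3P[/eqP pu /eqP xp /eqP yp].
exact: tN (twins_inner xy tw xp yp pu).
Qed.

(** [twins_pencil] falls short by one; a vertex far from both poles supplies it, or else the line
    through both poles from [twins_edge]. *)
Lemma twins_large x y u v : d x y = 3 -> twins x y u v -> 2 <= #|sphere2 x y 1 2| ->
  #|sphere2 x y 1 2| <= #|offside d x y :&: offside d y x| + #|fresh x y|.
Proof.
move=> xy tw A2; have [xu yu xv yv E] := tw.
have [R0|[w wR]] := set_0Vmem (offside d x y :&: offside d y x); last first.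
  have R1 : 0 < #|offside d x y :&: offside d y x| by apply/card_gt0P; exists w.
  have H : #|sphere2 x y 1 2| + 0 <= #|fresh x y|.+1 by apply: (twins_pencil (t := [::]) xy tw).
  by move: H; rewrite /reverse_coercion; lia.
have cov w : 2 <= d x w -> d y w <= 1.
  by move=> xw; have := in_remote w xy; rewrite R0 inE xw; brute.
have [a aA] : exists a, a \in sphere2 x y 1 2 :\ u.
  apply/set0Pn; rewrite -card_gt0; have := cardsD1 u (sphere2 x y 1 2).
  by rewrite in_sphere2 xu yu; move: A2; lia.
move: aA; rewrite in_setD1 in_sphere2 => /and3P[/eqP au /eqP xa /eqP ya].
have [l lf /andP[xl yl]] := twins_edge xy cov tw xa ya au.
have := twins_pencil (t := [:: l]) xy tw isT; rewrite R0 cards0 addn1 ltnS; apply.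
  by move=> l'; rewrite inE => /eqP ->.
move=> p xp yp vp; rewrite /= andbT; apply: (neq_set_witness (z := x)); rewrite xl.
by brute.
Qed.

Lemma twins_edges x y u v u' v' : d x y = 3 -> twins x y u v -> twins x y u' v' ->
  u <> u' -> v <> v' ->
  [/\ L x u = L x v \/ L x u \in fresh x y, L v y = L x v \/ L v y \in fresh x y,
     L x u != L x u' & L x u != L v' y] /\ L v y != L v' y.
Proof.
move=> xy tw tw' uu vv; have [xu yu xv yv E] := tw; have [xu' yu' xv' yv' E'] := tw'.
have [uv _] := twin_facts M xy xu yu xv yv E.
have [uv' _] := twin_facts M xy xu' yu' xv' yv' E'.
have yx : d y x = 3 by rewrite (gm_sym M).
have vu' := twins_inner xy tw xu' yu' (nesym uu).
have v'u := twins_inner xy tw' xu yu uu.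
split; last differ_at u.
split.
- have [|nf] := boolP (L x u \in fresh x y); [by right | left].
  have [||E2|//|->//] := plain_not_fresh M xu yu xv yv _ _ nf; try by brute.
  by exfalso; have: v' \in L x y; [brute | rewrite -E2; brute].
- have [|nf] := boolP (L v y \in fresh x y); [by right | left].
  have [||E2|//|->//] := plain_not_fresh M xu yu xv yv _ _ nf; try by brute.
  by exfalso; have: u' \in L x y; [brute | rewrite -E2; brute].
- differ_at v.
differ_at u.
Qed.

(** A vertex [w] off [L u v] has equal distances to [x], [u], [v], [y], at least 2, so it is far
    from both poles. The second unit is the line [L v w] at distance 2, and a neighbour of [w]
    towards [x], also far from both poles, at distance 3. *)
Lemma twins_thin x y u v : d x y = 3 -> twins x y u v -> L x u = L x v -> L v y = L x v ->
  #|sphere2 x y 1 2| < #|offside d x y :&: offside d y x| + #|fresh x y|.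
Proof.
move=> xy tw E1 E2; have [xu yu xv yv E] := tw.
have [uv four] := twin_facts M xy xu yu xv yv E.
have [w wL] : exists w, w \notin L u v by apply: nouniv; brute.
have wN : w \notin L x v.
  by apply: contra wL => /four[] ->; brute.
have uw : d u w = d x w by move: (wN); rewrite -E1; tri x u w; brute.
have vw : d v w = d y w by move: (wN); rewrite -E2; tri y v w; brute.
have xw : d x w = d y w by rewrite -uw -vw; move: wL; tri u v w; brute.
have xw2 : 2 <= d x w by move: xw uw; tri x y w; tri x u w; brute.
have wR : w \in offside d x y :&: offside d y x by rewrite in_remote // -xw xw2.
have [xw'|xw'] : d x w = 2 \/ d x w = 3 by move: xw2; brute.
  have yw : d y w = 2 by rewrite -xw.
  have vw' : d v w = 2 by rewrite vw.
  have R1 : 0 < #|offside d x y :&: offside d y x| by apply/card_gt0P; exists w.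
  suff H : #|sphere2 x y 1 2| + 1 <= #|fresh x y|.+1.
    by move: H; rewrite /reverse_coercion; lia.
  apply: (twins_pencil (t := [:: L v w]) xy tw) => //.
    by move=> l; rewrite inE => /eqP ->; apply: (plain_fresh_avoiding M xy); brute.
  move=> p xp yp vp; rewrite /= andbT; apply/eqP => /(mline_inj M).
  by rewrite vp vw' => /(_ isT erefl) pw; move: xp; rewrite pw xw'.
have [p wp xp] := gm_prev M xw'.
have pR : p \in offside d x y :&: offside d y x.
  by rewrite in_remote // xp; move: xw; tri y w p; brute.
have pw : p != w by apply/eqP => e; move: xp; rewrite e xw'.
have R2 : 2 <= #|offside d x y :&: offside d y x|.
  apply: (@card_ge_uniq _ _ [:: p; w]); first by rewrite /= inE pw.
  by apply/allP; rewrite /= pR wR.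
have H : #|sphere2 x y 1 2| + 0 <= #|fresh x y|.+1 by apply: (twins_pencil (t := [::]) xy tw).
by move: H; rewrite /reverse_coercion; lia.
Qed.

Definition twinned x y :=
  [set u in sphere2 x y 1 2 | [exists v in sphere2 x y 2 1, L x v == L y u]].

Lemma twinnedP x y u : u \in twinned x y -> exists v, twins x y u v.
Proof.
rewrite inE in_sphere2 => /andP[/andP[/eqP xu /eqP yu] /existsP[v]].
by rewrite in_sphere2 => /andP[/andP[/eqP xv /eqP yv] /eqP E]; exists v.
Qed.

Hypothesis nospecial : forall p z z', d p z = 2 -> d p z' = 3 -> L p z <> L p z'.

Lemma twinned_le x y : d x y = 3 -> twinned x y != set0 ->
  #|twinned x y| < #|offside d x y :&: offside d y x| + #|fresh x y|.
Proof.
move=> xy /set0Pn[u /[dup] uT /twinnedP[v tw]]; have [xu yu xv yv E] := tw.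
have yx : d y x = 3 by rewrite (gm_sym M).
have TA : twinned x y \subset sphere2 x y 1 2 by apply/subsetP => z; rewrite inE => /andP[].
have T0 : 0 < #|twinned x y| by rewrite (cardsD1 u) uT.
have [lA|eA] := boolP (#|twinned x y| < #|sphere2 x y 1 2|).
  by apply: (leq_trans lA); apply: (twins_large xy tw); apply: (leq_ltn_trans T0 lA).
have eTA : twinned x y = sphere2 x y 1 2 by apply/eqP; rewrite eqEcard TA leqNgt.
have BC : sphere2 y x 1 2 = sphere2 x y 2 1.
  by apply/setP => z; rewrite !in_sphere2 andbC.
have [lB|eB] := boolP (#|twinned x y| < #|sphere2 x y 2 1|).
  apply: (leq_trans lB); rewrite -BC setIC -(freshC M); apply: (twins_large yx (twinsC tw)).
  by rewrite BC; apply: (leq_ltn_trans T0 lB).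
have uA : u \in sphere2 x y 1 2 by rewrite in_sphere2 xu yu.
have vB : v \in sphere2 x y 2 1 by rewrite in_sphere2 xv yv.
(* If [u] is the only vertex of type (1, 2), then [v] is the only one of type (2, 1), and
   [L x y = L x v] contradicts [nospecial]. *)
have [A0|[u' u'A]] := set_0Vmem (sphere2 x y 1 2 :\ u).
  have cA : #|sphere2 x y 1 2| = 1 by rewrite (cardsD1 u) uA A0 cards0.
  have B0 : sphere2 x y 2 1 :\ v = set0.
    apply/eqP; rewrite -cards_eq0; have := cardsD1 v (sphere2 x y 2 1).
    by move: eB; rewrite vB eTA cA; lia.
  have [uv four] := twin_facts M xy xu yu xv yv E.
  case: (nospecial xv xy); apply/setP => w; apply/idP/idP.
    by case/four=> ->; brute.
  move=> wl; have [[h|h]|h] : (d x w = 0 \/ d y w = 0) \/ (w \in sphere2 x y 1 2 \/ w \in sphere2 x y 2 1).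
  - by move: wl; rewrite !in_sphere2; tri x y w; brute.
  - by rewrite -(gm_sep M h); brute.
  - by rewrite -(gm_sep M h); brute.
  case: h => h.
    by have: w \notin sphere2 x y 1 2 :\ u; [rewrite A0 inE | rewrite in_setD1 h andbT negbK => /eqP ->; brute].
  by have: w \notin sphere2 x y 2 1 :\ v; [rewrite B0 inE | rewrite in_setD1 h andbT negbK => /eqP ->; brute].
move: u'A; rewrite in_setD1 -eTA => /andP[/eqP u'u /twinnedP[v' tw']].
have vv' : v <> v'.
  move=> vv; case: u'u; have [xu' yu' xv' yv' E'] := tw'.
  by apply: (mline_inj M (x := y)); rewrite ?yu ?yu' // -E' -E vv.
have [[F1 F2 N1 N2] N3] := twins_edges xy tw tw' (nesym u'u) vv'.
have [[F1' F2' _ N2'] _] := twins_edges xy tw' tw u'u (nesym vv').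
have thin u0 v0 : twins x y u0 v0 -> L x u0 = L x v0 -> L v0 y = L x v0 ->
    #|twinned x y| < #|offside d x y :&: offside d y x| + #|fresh x y|.
  by rewrite eTA; apply: twins_thin.
have two l1 l2 : l1 \in fresh x y -> l2 \in fresh x y -> l1 != l2 -> x \in l1 -> x \in l2 ->
    #|twinned x y| < #|offside d x y :&: offside d y x| + #|fresh x y|.
  move=> f1 f2 n12 x1 x2; rewrite eTA.
  suff H : #|sphere2 x y 1 2| + 2 <= #|fresh x y|.+1.
    by rewrite addn2 ltnS in H; apply: leq_trans H (leq_addl _ _).
  apply: (twins_pencil (t := [:: l1; l2]) xy tw).
  - by rewrite /= inE n12.
  - by apply/allP; rewrite /= f1 f2.
  by move=> p xp yp vp; rewrite /= andbT; apply/andP; split;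
    apply: (neq_set_witness (z := x)); rewrite ?x1 ?x2; brute.
have [xu' yu' xv' yv' E'] := tw'.
have xX : x \in L x u by brute.
have xY : x \in L v y by brute.
have xX' : x \in L x u' by brute.
have xY' : x \in L v' y by have [uv _] := twin_facts M xy xu' yu' xv' yv' E'; brute.
rewrite eq_sym in N2'.
(* Either both edge lines of one twin pair collapse to its path and [twins_thin] applies, or each
   pair provides a fresh line through [x], and the two differ. *)
by case: F1 => F1; case: F2 => F2; case: F1' => F1'; case: F2' => F2';
  first [exact: thin tw F1 F2 | exact: thin tw' F1' F2' | exact: two F1 F1' N1 xX xX'
       | exact: two F1 F2' N2 xX xY' | exact: two F2 F1' N2' xY xX' | exact: two F2 F2' N3 xY xY'].
Qed.

(** Without special triples, [L x y] is outside both families and each family is injective; dropping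
    the twinned vertices from one makes them disjoint. *)
Lemma card_plain_base x y : d x y = 3 ->
  1 + #|sphere2 x y 1 2| + #|sphere2 x y 2 1| <= #|plain_base d x y| + #|twinned x y|.
Proof.
move=> xy; have yx : d y x = 3 by rewrite (gm_sym M).
pose X := [set L x v | v in sphere2 x y 2 1].
pose Y := [set L y u | u in sphere2 x y 1 2 :\: twinned x y].
have cX : #|X| = #|sphere2 x y 2 1|.
  apply: card_in_imset => p q; rewrite !in_sphere2 => /andP[/eqP xp _] /andP[/eqP xq _].
  by apply: (mline_inj M); rewrite xp // xq.
have cY : #|Y| = #|sphere2 x y 1 2 :\: twinned x y|.
  apply: card_in_imset => p q; rewrite !in_setD !in_sphere2 => /and3P[_ _ /eqP yp] /and3P[_ _ /eqP yq].
  by apply: (mline_inj M); rewrite yp // yq.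
have XY : X :&: Y = set0.
  apply/setP => l; rewrite !inE; apply/negP => /andP[/imsetP[v vB ->] /imsetP[u + E]].
  rewrite in_setD => /andP[/negP nt uA]; case: nt; rewrite inE uA.
  by apply/existsP; exists v; rewrite vB E eqxx.
have nXY : L x y \notin X :|: Y.
  rewrite in_setU; apply/norP; split; apply/negP => /imsetP[z].
    by rewrite in_sphere2 => /andP[/eqP xz _] E; apply: (nospecial xz xy).
  rewrite in_setD in_sphere2 => /and3P[_ _ /eqP yz] E; apply: (nospecial yz yx).
  by rewrite -E (mlineC M).
have sub : L x y |: (X :|: Y) \subset plain_base d x y.
  by apply/setUS/setUS/imsetS/subsetDl.
have := subset_leq_card sub; rewrite cardsU1 nXY cardsU XY cards0 subn0 cX cY.
have := cardsID (twinned x y) (sphere2 x y 1 2).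
have := subset_leq_card (subsetIr (sphere2 x y 1 2) (twinned x y)).
rewrite /reverse_coercion; lia.
Qed.

Lemma blocked0 x : blocked x = set0.
Proof.
apply/setP => z; rewrite [RHS]inE; apply/negP => /blockedP[z' [xz xz' E]].
exact: nospecial xz xz' E.
Qed.

Lemma plain_lines x y : d x y = 3 -> #|T| <= #|mlines d|.
Proof.
move=> xy; have sub : plain_base d x y \subset mlines d.
  apply/subsetP => l; rewrite in_setU1 in_setU => /or3P[/eqP ->|/imsetP[v + ->]|/imsetP[u + ->]].
  - by apply: (mem_mlines M); brute.
  - by rewrite in_sphere2 => /andP[/eqP xv _]; apply: (mem_mlines M); brute.
  by rewrite in_sphere2 => /andP[_ /eqP yu]; apply: (mem_mlines M); brute.
have := card_lines_ge M xy sub (plain_base_mem M xy).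
rewrite !blocked0 !setI0 !cards0; have := card_plain_base xy.
(* With nothing blocked, the count is short by [1 + #|twinned x y|], hence the strict inequality. *)
suff: #|twinned x y| < #|offside d x y :&: offside d y x| + #|fresh x y|.
  rewrite /reverse_coercion; lia.
have [T0|] := eqVneq (twinned x y) set0; last exact: twinned_le.
have [R0|[w wR]] := set_0Vmem (offside d x y :&: offside d y x); last first.
  by rewrite T0 cards0 addn_gt0; apply/orP; left; apply/card_gt0P; exists w.
rewrite T0 R0 !cards0 add0n; apply/card_gt0P; apply: (untwinned_fresh M nouniv xy).
  by move=> w xw; have := in_remote w xy; rewrite R0 inE xw; brute.
move=> u v xu yu xv yv E; have: u \notin twinned x y by rewrite T0 inE.
case/negP; rewrite inE in_sphere2 xu yu; apply/existsP; exists v.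
by rewrite in_sphere2 xv yv E !eqxx.
Qed.
End Twins.

(** * Conclusion for graphs of diameter three *)

Lemma card_mlines_ge (T : finType) (d : T -> T -> nat) :
  graph_metric3 d -> (forall p q, 0 < d p q -> mline d p q != setT) ->
  (exists x y, d x y = 3) -> #|T| <= #|mlines d|.
Proof.
move=> M nouniv [x [y xy]].
have miss p q : 0 < d p q -> exists w, w \notin mline d p q.
  by move=> pq; have := nouniv p q pq; rewrite -subTset => /subsetPn[w _ wl]; exists w.
have [/existsP[p /existsP[z /existsP[z' /and3P[/eqP pz /eqP pz' /eqP E]]]]|nsp] :=
  boolP [exists p, exists z, exists z', [&& d p z == 2, d p z' == 3 & mline d p z == mline d p z']].
  exact: (special_lines M miss pz' pz E).
apply: (plain_lines M miss _ xy) => p z z' pz pz' E; case/negP: nsp.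
by apply/existsP; exists p; apply/existsP; exists z; apply/existsP; exists z'; rewrite pz pz' E !eqxx.
Qed.

Theorem mainTheorem2 (T : finType) (e : rel T)
    (e_sym : symmetric e) (e_irr : irreflexive e)
    (e_conn : connected_graph e) (e_diam : diameter e = 3) :
  (exists x y : T, x != y /\ line e x y = [set: T]) \/ #|T| <= #|lines e|.
Proof.
have le3 x y : dist e x y <= 3.
  rewrite -e_diam; apply: leq_trans (leq_bigmax x).
  exact: (leq_bigmax (F := dist e x) y).
have M := dist_graph_metric e_sym e_conn le3.
have [/existsP[x /existsP[y /andP[xy /eqP E]]]|nu] :=
    boolP [exists x, exists y, (x != y) && (line e x y == setT)].
  by left; exists x, y.
right; have <- : mlines (dist e) = lines e.
  by apply/setP => l; apply/imset2P/imset2P => -[x y xT xy ->]; exists x y;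
    rewrite ?(mline_dist M) //; move: xy; rewrite !inE.
apply: card_mlines_ge => // [p q pq|].
  have npq : p != q by rewrite (gm_eq0 M) -lt0n.
  rewrite mline_dist //; apply: contra nu => E.
  by apply/existsP; exists p; apply/existsP; exists q; rewrite npq.
have [/existsP[x /existsP[y /eqP xy]]|n3] := boolP [exists x, exists y, dist e x y == 3].
  by exists x, y.
suff: diameter e <= 2 by rewrite e_diam.
apply/bigmax_leqP => x _; apply/bigmax_leqP => y _; rewrite -ltnS ltn_neqAle le3 andbT.
by apply: contra n3 => xy; apply/existsP; exists x; apply/existsP; exists y.
Qed.
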